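(* Let $\Phi$ be a Young function with complementary Young function $\Psi$, let $u:\Omega\to\mathbb{C}$ be $\Sigma$-measurable, and suppose $T=EM_u:L^{\Phi}(\Omega,\Sigma,\mu)\to L^0(\Omega,\Sigma,\mu)$, $T(f)=E(uf)$, is well defined. Then the following hold. (a) If $T$ is bounded on $L^{\Phi}(\Omega,\Sigma,\mu)$, then $E(u)\in L^{\infty}(\Omega,\mathcal{A},\mu)$. (b) If $\Phi\in\Delta'$ (globally) and $T$ is bounded on $L^{\Phi}(\Omega,\Sigma,\mu)$, then $\Psi^{-1}(E(\Psi(u)))\in L^{\infty}(\mathcal{A})$. (c) If $(E,\Phi)$ satisfies the generalized conditional-type Hölder inequality, with constant $C$, and $\Psi^{-1}(E(\Psi(u)))\in L^{\infty}(\mathcal{A})$, then $T$ is bounded on $L^{\Phi}(\Omega,\Sigma,\mu)$. In this case, $\|T\|\le C\,\|\Psi^{-1}(E(\Psi(u)))\|_{\infty}$.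
   Context: $(\Omega,\Sigma,\mu)$ is a measure space and $\mathcal{A}\subseteq\Sigma$ is a sub-$\sigma$-algebra with $(\Omega,\mathcal{A},\mu|_{\mathcal{A}})$ $\sigma$-finite; in particular it has the finite subset property (every $A\in\mathcal{A}$ with $\mu(A)>0$ contains some $B\in\mathcal{A}$ with $0<\mu(B)<\infty$). $E=E^{\mathcal{A}}$ is the conditional expectation with respect to $\mathcal{A}$: $E(f)$ is the a.e. unique $\mathcal{A}$-measurable function with $\int_A f\,d\mu=\int_A E(f)\,d\mu$ for all $A\in\mathcal{A}$, defined for nonnegative $f$ (with values in $[0,\infty]$) and extended to complex $f$ with $E(|f|)<\infty$ a.e. $L^0(\Omega,\Sigma,\mu)$ is the space of (a.e. classes of) $\Sigma$-measurable functions; $L^\infty(\mathcal{A})=L^\infty(\Omega,\mathcal{A},\mu|_{\mathcal{A}})$. A Young function is a continuous convex $\Phi:\mathbb{R}\to[0,\infty)$ with $\Phi(x)=0$ iff $x=0$, $\Phi(-x)=\Phi(x)$, and $\lim_{x\to\infty}\Phi(x)/x=\infty$. Its complementary Young function is $\Psi(y)=\sup\{x|y|-\Phi(x):x\ge 0\}$. $\Phi^{-1},\Psi^{-1}$ are the inverses of the restrictions to $[0,\infty)$ (with value $\infty$ at $\infty$, and $0\cdot\infty=0$). For complex-valued $f$, $\Phi(f)$ means $\Phi(|f|)$, and likewise for $\Psi$. $\Phi\in\Delta'$ (globally) means there is $c>0$ with $\Phi(xy)\le c\,\Phi(x)\Phi(y)$ for all $x,y\ge 0$. $L^{\Phi}(\Omega,\Sigma,\mu)=L^\Phi(\Sigma)$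 is the Orlicz space of $\Sigma$-measurable $f:\Omega\to\mathbb{C}$ with $\int_\Omega\Phi(kf)\,d\mu<\infty$ for some $k>0$, with norm $N_\Phi(f)=\inf\{k>0:\int_\Omega\Phi(f/k)\,d\mu\le 1\}$. ''$T$ bounded on $L^\Phi$'' means $T$ maps $L^\Phi(\Sigma)$ boundedly into itself, with operator norm $\|T\|$. $(E,\Phi)$ satisfies the generalized conditional-type Hölder inequality with constant $C>0$ if for all $f\in L^{\Phi}(\Omega,\Sigma,\mu)$ and $g\in L^{\Psi}(\Omega,\Sigma,\mu)$, almost everywhere, $$E(|fg|)\le C\,\Phi^{-1}(E(\Phi(|f|)))\,\Psi^{-1}(E(\Psi(|g|))).$$ *)

(* Defs.v *)
From mathcomp Require Export all_boot all_order all_algebra.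
From mathcomp Require Export all_classical all_reals all_analysis.
From mathcomp Require Export measurable_realfun ess_sup_inf complex.

Set Implicit Arguments.
Unset Strict Implicit.
Unset Printing Implicit Defensive.

Import Order.TTheory GRing.Theory Num.Theory.
Import numFieldNormedType.Exports.

Local Open Scope classical_set_scope.
Local Open Scope ring_scope.

Section young_functions.
Context {R : realType}.
Implicit Types Phi : R -> R.

Definition young Phi : Prop :=
  [/\ continuous Phi,
      convex_function [set: convex_lmodType R^o] (Phi : R^o -> R^o),
      forall x, 0 <= Phi x,
      forall x, Phi x = 0 <-> x = 0
    & (forall x, Phi (- x) = Phi x) /\ Phi x / x @[x --> +oo] --> +oo].

(* When [Phi] is Young, the set below is nonempty and bounded above because
   [Phi x / x] tends to infinity, so the real [sup] is the true supremum. *)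
Definition complementary Phi (y : R) : R :=
  sup [set x * `|y| - Phi x | x in `[0, +oo[].

(* Inverse of the restriction of [Phi] to [0, +oo[, extended by +oo |-> +oo;
   its value at -oo is irrelevant. *)
Definition young_inv Phi : \bar R -> \bar R :=
  er_map ('pinv_(fun=> 0) `[0, +oo[ Phi).

Definition Delta' Phi : Prop :=
  exists2 c : R, 0 < c &
    forall x y, 0 <= x -> 0 <= y -> Phi (x * y) <= c * (Phi x * Phi y).

End young_functions.

Section complex_valued.
Context {R : realType}.

Definition cmodulus (z : R[i]) : R := Normc.normc z.

Definition cmeasurable d (X : measurableType d) (f : X -> R[i]) : Prop :=
  measurable_fun [set: X] (@complex.Re R \o f) /\ measurable_fun [set: X] (@complex.Im R \o f).

(* [Phi (|f|)], as an extended-real function. *)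
Definition Phi_of (X : Type) (Phi : R -> R) (f : X -> R[i]) (x : X) : \bar R :=
  (Phi (cmodulus (f x)))%:E.

End complex_valued.

Section orlicz.
Context d (X : measurableType d) {R : realType}.
Variables (mu : {measure set X -> \bar R}) (Phi : R -> R).
Local Open Scope ereal_scope.

Definition orlicz (f : X -> R[i]) : Prop :=
  cmeasurable f /\
  exists2 k : R, (0 < k)%R &
    \int[mu]_x (Phi (k * cmodulus (f x)))%:E < +oo.

(* [N_Phi f]; extended-real, so that an empty infimum is +oo. *)
Definition luxemburg (f : X -> R[i]) : \bar R :=
  ereal_inf [set k%:E | k in [set k : R | (0 < k)%R /\
    \int[mu]_x (Phi (cmodulus (f x) / k))%:E <= 1]].

Definition orlicz_bounded (T : (X -> R[i]) -> (X -> R[i])) : Prop :=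
  (forall f, orlicz f -> orlicz (T f)) /\
  exists2 M : R, (0 <= M)%R &
    forall f, orlicz f -> luxemburg (T f) <= M%:E * luxemburg f.

Definition orlicz_opnorm (T : (X -> R[i]) -> (X -> R[i])) : \bar R :=
  ereal_sup [set luxemburg (T f) | f in
    [set f | orlicz f /\ luxemburg f <= 1]].

End orlicz.

(* A sub-sigma-algebra is a set [A] of measurable sets of [X]; the measurable
   space (X, A) is [g_sigma_algebraType A], whose measurable sets are <<s A>>,
   that is, [A] itself when [A] is a sigma-algebra. *)
Section conditional_expectation.
Context d (X : measurableType d) {R : realType}.
Variables (mu : {measure set X -> \bar R}) (A : set (set X)).
Local Open Scope ereal_scope.

Local Notation XA := (g_sigma_algebraType A).

Definition sub_sigma_algebra : Prop :=
  sigma_algebra [set: X] A /\ A `<=` measurable.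

Definition is_condexp (f g : X -> \bar R) : Prop :=
  [/\ measurable_fun [set: XA] (g : XA -> \bar R),
      forall x, 0 <= g x
    & forall B, A B -> \int[mu]_(x in B) f x = \int[mu]_(x in B) g x].

(* A version of [E f] for nonnegative measurable [f]. It exists when [mu] is
   sigma-finite on [A] (Radon-Nikodym), and is a.e. unique; the default value
   [cst 0] is used for no such [f]. *)
Definition condexp (f : X -> \bar R) : X -> \bar R :=
  xget (cst 0) [set g | is_condexp f g].

(* The complex functions in the domain of [E]. *)
Definition conditionable (f : X -> R[i]) : Prop :=
  cmeasurable f /\
  {ae mu, forall x, condexp (fun x => (cmodulus (f x))%:E) x < +oo}.

Definition rcondexp (h : X -> R) (x : X) : R :=
  (fine (condexp (EFin \o h^\+)%R x) - fine (condexp (EFin \o h^\-)%R x))%R.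

(* Only meaningful for [conditionable f]: then the four conditional
   expectations involved are finite a.e. *)
Definition ccondexp (f : X -> R[i]) (x : X) : R[i] :=
  (rcondexp (@complex.Re R \o f) x +i* rcondexp (@complex.Im R \o f) x)%C.

Definition condexp_mul (u f : X -> R[i]) : X -> R[i] :=
  ccondexp (fun x => u x * f x)%R.

(* Membership in L^oo(X, A, mu|A), for extended-real and complex functions. *)
Definition Linfty (g : X -> \bar R) : Prop :=
  measurable_fun [set: XA] (g : XA -> \bar R) /\ 'N[mu]_+oo[g] < +oo.

Definition cLinfty (g : X -> R[i]) : Prop :=
  @cmeasurable R _ XA g /\ 'N[mu]_+oo[EFin \o cmodulus \o g] < +oo.

(* The generalized conditional-type Hoelder inequality with constant [C]. *)
Definition cond_hoelder (Phi : R -> R) (C : R) : Prop :=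
  let Psi := complementary Phi in
  forall f g, orlicz mu Phi f -> orlicz mu Psi g ->
  {ae mu, forall x,
    condexp (fun x => (cmodulus (f x * g x))%:E) x <=
    C%:E * young_inv Phi (condexp (Phi_of Phi f) x)
         * young_inv Psi (condexp (Phi_of Psi g) x)}.

End conditional_expectation.

(* Main.v *)
From HB Require Import structures.
Require Import Defs.
From mathcomp Require Import ring lra.

(** Write E for the conditional expectation with respect to A and Psi for the
complementary function of Phi. Each necessary condition comes from one explicit
test function, localized on a set B of A of finite measure. Boundedness of T is
used in its modular form: for some M > 0, if the integral of Phi(|f|) is at most
1, so is that of Phi(|T f| / M) ([bounded_modular]).

For E(u), take f = t 1_B with Phi(t) mu(B) = 1, so that |T f| = t |E(u)| on B.
If |E(u)| exceeded 2 M on B, convexity would make the modular of T f / M at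
least 2 ([bounded_ccondexp]). Finiteness of E(|u|) almost everywhere comes
from T being defined on the functions 1_B ([conditionable_of_finite_sets]).

For E(Psi(u)), the test function is f = t v 1_B, restricted to the set where
|u| <= n, with v = Psi(|u|) conj(u) / (2 |u|^2). Then u v = Psi(|u|) / 2, while
Phi(|v|) <= Psi(|u|) / 2 by Young duality. With S = E(Psi(u) 1_{|u| <= n}) this
gives T f = t S / 2 on B and, by Delta', a modular of f at most
c Phi(t) (int_B S) / 2, which is 1 for a suitable t. The remaining point is that
a function in Delta' whose complementary function does not vanish on ]0, +oo[
grows superlinearly at every scale: given K there is l > 0 with
K z Phi(t) <= Phi(z t) for all t and all z >= 1/l ([Delta'_superlinear]). With
K = 2 M c, if S > 2 M / l on B then the modular of T f / M is at least 2. Hence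
S <= 2 M / l almost everywhere ([condexp_truncated_le]), and n goes to infinity.

For the converse, the Hoelder inequality is applied to f / k and u 1_B, which
lies in L^Psi because E(Psi(u)) <= Psi(W) for every W > 0 above the essential
supremum of Psi^-1(E(Psi(u))). Together with |T f| <= E(|u f|)
([cmodulus_ccondexp_le]) it yields
Phi(|T f| / (k C W)) <= E(Phi(f / k)) almost everywhere
([condexp_mul_modular_ae]); integrating bounds the norm of T by C W.

What this requires from conditional expectation (existence, monotonicity, additivity,
pulling out A-measurable factors) is deduced from the Radon-Nikodym theorem. Both
existence for arbitrary nonnegative functions and the pull-out property are
reduced to indicators by writing a nonnegative measurable function as a series
of multiples of indicators ([ge0_series_indic]). *)

Set Implicit Arguments.
Unset Strict Implicit.
Unset Printing Implicit Defensive.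
Import Order.TTheory GRing.Theory Num.Theory.
Import numFieldNormedType.Exports.
Local Open Scope classical_set_scope.
Local Open Scope ring_scope.

(** * Young functions *)

Section young_theory.
Context {R : realType} (Phi : R -> R).
Hypothesis yPhi : young Phi.

Lemma young_ge0 x : 0 <= Phi x.
Proof. by case: yPhi. Qed.

Lemma young0 : Phi 0 = 0.
Proof. by case: yPhi => _ _ _ /(_ 0)[_ ->]. Qed.

Lemma young_gt0 x : x != 0 -> 0 < Phi x.
Proof.
move=> x0; rewrite lt_neqAle young_ge0 andbT eq_sym.
by apply: contra_neq x0; case: yPhi => _ _ _ /(_ x)[+ _] _.
Qed.

Lemma young_scale_le t x : 0 <= t -> t <= 1 -> Phi (t * x) <= t * Phi x.
Proof.
move=> t0 t1; case: yPhi => _ cvx _ _ _.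
have := cvx (Itv01 t0 t1) x 0 (mem_set I) (mem_set I).
rewrite convRE /= young0 mulr0 addr0.
have -> : (conv (Itv01 t0 t1) (x : convex_lmodType R^o) 0 : R) = t * x.
  by rewrite /conv /= scaler0 addr0.
by [].
Qed.

Lemma young_scale_ge a x : 1 <= a -> a * Phi x <= Phi (a * x).
Proof.
move=> a1; have a0 : 0 < a by exact: lt_le_trans a1.
rewrite -ler_pdivlMl// -{1}(mulKf (lt0r_neq0 a0) x).
by apply: young_scale_le; [rewrite invr_ge0 ltW | rewrite invf_le1].
Qed.

Lemma young_le x y : 0 <= x -> x <= y -> Phi x <= Phi y.
Proof.
move=> x0 xy; have [y0|y0] := eqVneq y 0.
  by rewrite (_ : x = 0) ?y0//; apply/eqP; rewrite eq_le x0 -y0 xy.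
have yp : 0 < y by rewrite lt_neqAle eq_sym y0 (le_trans x0).
have t1 : x / y <= 1 by rewrite ler_pdivrMr// mul1r.
rewrite -{1}(divfK y0 x) (le_trans (young_scale_le _ _ _)) ?divr_ge0// ?(ltW yp)//.
by rewrite ler_piMl// young_ge0.
Qed.

Lemma young_lt x y : 0 <= x -> x < y -> Phi x < Phi y.
Proof.
move=> x0 xy; have yp : 0 < y by exact: le_lt_trans xy.
have t1 : x / y < 1 by rewrite ltr_pdivrMr// mul1r.
rewrite -{1}(divfK (lt0r_neq0 yp) x).
rewrite (le_lt_trans (young_scale_le _ (divr_ge0 x0 (ltW yp)) (ltW t1)))//.
by rewrite gtr_pMl// young_gt0// gt_eqF.
Qed.

Lemma young_leE x y : 0 <= x -> 0 <= y -> (Phi x <= Phi y) = (x <= y).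
Proof.
by move=> x0 y0; case: (leP x y) => [/young_le->//|/young_lt]; rewrite ltNge => /(_ y0)/negbTE.
Qed.

Lemma young_inj : {in `[0, +oo[%classic &, injective Phi}.
Proof.
move=> x y; rewrite !in_setE/= !in_itv/= !andbT => x0 y0 e.
by apply/eqP; rewrite eq_le -(young_leE x0 y0) -(young_leE y0 x0) e lexx.
Qed.

Lemma young_surj y : 0 <= y -> exists2 x, 0 <= x & Phi x = y.
Proof.
move=> y0; have P1 : 0 < Phi 1 by rewrite young_gt0// oner_eq0.
pose b := 1 + y / Phi 1.
have b1 : 1 <= b by rewrite lerDl divr_ge0// ltW.
have yb : y <= Phi b.
  rewrite -[b]mulr1 (le_trans _ (young_scale_ge _ b1))// mulrDl mul1r.
  by rewrite divfK ?gt_eqF// lerDr ltW.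
have b0 : 0 <= b by exact: le_trans b1.
have [||x] := @IVT R Phi 0 b y b0.
- by apply: continuous_subspaceT => x; case: yPhi => + _ _ _ _; apply.
- by rewrite ge_min le_max young0 y0 yb orbT.
by rewrite in_itv/= => /andP[x0 _]; exists x.
Qed.

Local Notation inv := ('pinv_(fun=> 0) `[0, +oo[ Phi).

Lemma young_invK y : 0 <= y -> 0 <= inv y /\ Phi (inv y) = y.
Proof.
move=> y0.
have yim : y \in Phi @` `[0, +oo[.
  have [x x0 xy] := young_surj y0.
  by rewrite in_setE; exists x => //=; rewrite in_itv/= andbT.
have := @pinvK _ _ (fun=> 0) `[0, +oo[ Phi _ yim => e; split => //.
have [x x0 xy] := young_surj y0.
rewrite -xy pinvKV//.
  exact: young_inj.
by rewrite in_setE/= in_itv/= andbT.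
Qed.

Lemma young_inv_ge0 (e : \bar R) : (0 <= e)%E -> (0 <= young_inv Phi e)%E.
Proof.
case: e => [y| |]//=; rewrite !lee_fin => y0.
by have [] := young_invK y0.
Qed.

Lemma young_inv_le (e : \bar R) (c : R) : (0 <= e)%E -> 0 <= c ->
  (young_inv Phi e <= c%:E)%E = (e <= (Phi c)%:E)%E.
Proof.
case: e => [y| |]//= + c0; rewrite !lee_fin => y0.
have [i0 iK] := young_invK y0.
by rewrite -(young_leE i0 c0) iK.
Qed.

Lemma le_young_inv (e : \bar R) (c : R) : (0 <= e)%E -> 0 <= c ->
  (c%:E <= young_inv Phi e)%E = ((Phi c)%:E <= e)%E.
Proof.
case: e => [y| |]//= + c0; last by rewrite !leey.
rewrite !lee_fin => y0.
have [i0 iK] := young_invK y0.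
by rewrite -(young_leE c0 i0) iK.
Qed.

Lemma measurable_young : measurable_fun [set: R] Phi.
Proof. by apply: continuous_measurable_fun; case: yPhi. Qed.

(** The inverse takes default values below 0, where monotonicity would be lost;
since [e] is nonnegative it can be precomposed with [max 0], which makes it
nondecreasing on the whole line. *)
Lemma measurable_young_inv d (T : measurableType d) (e : T -> \bar R) :
  measurable_fun [set: T] e -> (forall x, 0 <= e x)%E ->
  measurable_fun [set: T] (fun x => young_inv Phi (e x)).
Proof.
move=> me e0; pose h := er_map (fun y => inv (Num.max 0 y)).
have -> : (fun x => young_inv Phi (e x)) = h \o e.
  apply/funext => x /=; rewrite /h /young_inv.
  by case: (e x) (e0 x) => [y| |]//=; rewrite lee_fin => y0; rewrite max_r.
apply: measurableT_comp => //; apply: (@measurable_er_map _ T).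
apply: nondecreasing_measurable => // a b ab.
have a0 : 0 <= Num.max 0 a by rewrite le_max lexx.
have b0 : 0 <= Num.max 0 b by rewrite le_max lexx.
have [ia aK] := young_invK a0; have [ib bK] := young_invK b0.
by rewrite -(young_leE ia ib) aK bK le_max2.
Qed.

(** If no [x] did better than [c], then [c] would be an upper bound of the set whose
supremum is taken. *)
Lemma complementary_approached c y : 0 <= y -> c < complementary Phi y ->
  exists2 x, 0 <= x & c < x * y - Phi x.
Proof.
move=> y0 cy; apply: contrapT => H; move: cy; rewrite ltNge => /negP; apply.
apply: ge_sup.
  by exists (0 * `|y| - Phi 0), 0 => //=; rewrite in_itv/= lexx.
move=> _ [x /= + <-]; rewrite in_itv/= andbT => x0.
rewrite ger0_norm// leNgt; apply/negP => h; apply: H; by exists x.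
Qed.

(** A weak form of the classical Phi(Psi(y) / y) <= Psi(y); the factor 1/2 dispenses
with a limit. Some [x] satisfies [x y - Phi x > Psi(y) / 2], hence both
[x > s := Psi(y) / (2 y)] and [Phi x < x y]; convexity through 0 then gives
[Phi s <= (s / x) Phi x <= s y]. *)
Lemma young_half_complementary y : 0 < y -> 0 < complementary Phi y ->
  Phi (complementary Phi y / (2 * y)) <= complementary Phi y / 2.
Proof.
move=> y0; set P := complementary Phi y => P0.
have [x x0 xP] : exists2 x, 0 <= x & P / 2 < x * y - Phi x.
  by apply: complementary_approached; [exact: ltW|rewrite -/P; lra].
have Px := young_ge0 x.
set s := P / (2 * y).
have sy : s * y = P / 2 by rewrite /s; field; exact: lt0r_neq0.
have s0 : 0 < s by rewrite divr_gt0// mulr_gt0.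
have sx : s < x by rewrite -(ltr_pM2r y0) sy; lra.
have xp : 0 < x by exact: lt_trans sx.
have s1 : s / x <= 1 by rewrite ler_pdivrMr// mul1r ltW.
have := young_scale_le x (divr_ge0 (ltW s0) x0) s1.
rewrite divfK ?lt0r_neq0// -sy => /le_trans; apply.
rewrite mulrAC -mulrA ler_pM2l// ler_pdivrMr// mulrC; lra.
Qed.

(** Positivity of the complementary function on ]0, +oo[ says exactly that
[Phi l / l] takes arbitrarily small values. *)
Lemma young_small_slope : young (complementary Phi) ->
  forall e, 0 < e -> exists2 l, 0 < l & Phi l < e * l.
Proof.
move=> [_ _ Pge0 P0 _] e e0.
have Pe : 0 < complementary Phi e.
  rewrite lt_neqAle Pge0 andbT eq_sym; apply/eqP => /P0 ez.
  by rewrite ez ltxx in e0.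
have [x x0 xP] := complementary_approached (ltW e0) Pe.
exists x; last by rewrite mulrC; lra.
rewrite lt_neqAle x0 andbT; apply/eqP => xz.
by move: xP; rewrite -xz young0 mul0r subrr ltxx.
Qed.

(** Delta' turns the small slope of [Phi] near 0 into fast growth everywhere:
choosing [l] with [c K Phi l <= l], one gets
[K Phi t <= K c Phi(l) Phi(t / l) <= l Phi(t / l)], and [Phi(t / l)] is at most
[Phi(z t) / (z l)] by convexity. This is where Delta' for all arguments, rather than
for large ones only, is needed. *)
Lemma Delta'_superlinear : young (complementary Phi) -> Delta' Phi ->
  forall K, 0 < K -> exists2 l, 0 < l &
    forall t z, 0 <= t -> l^-1 <= z -> K * z * Phi t <= Phi (z * t).
Proof.
move=> yPsi [c c0 D] K K0.
have [l l0 lP] := young_small_slope yPsi (divr_gt0 (ltr01 : 0 < 1 :> R) (mulr_gt0 c0 K0)).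
exists l => // t z t0 lz.
have z1 : 1 <= z * l by rewrite -ler_pdivrMr// mul1r.
have tl0 : 0 <= t / l by rewrite divr_ge0// ltW.
have -> : z * t = (z * l) * (t / l) by field; exact: lt0r_neq0.
apply: le_trans (young_scale_ge _ z1).
have tE : t = l * (t / l) by field; exact: lt0r_neq0.
have P0 := young_ge0 (t / l).
have Pt : Phi t <= c * (Phi l * Phi (t / l)) by rewrite {1}tE; exact: D (ltW l0) tl0.
have z0 : 0 < z by rewrite (lt_le_trans _ lz)// invr_gt0.
have KcP : K * c * Phi l <= l.
  rewrite -ler_pdivlMl ?mulr_gt0// mulrC ltW//.
  by move: lP; rewrite div1r mulrC [c * K]mulrC.
have key : K * Phi t <= l * Phi (t / l).
  rewrite (le_trans (ler_wpM2l (ltW K0) Pt))//.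
  by rewrite [leLHS](_ : _ = K * c * Phi l * Phi (t / l)); [exact: ler_wpM2r|ring].
rewrite [leLHS](_ : _ = z * (K * Phi t)); last by ring.
by rewrite -mulrA ler_pM2l.
Qed.

End young_theory.

Local Open Scope ereal_scope.

(** * Nonnegative measurable functions as series of indicators *)

Section greedy.
Context {R : realType} (T : Type) (f : T -> \bar R).

(** The partial sums of a greedy expansion of [f x] along the harmonic series: the
term 1/(m+1) is added whenever the result stays below [f x]. *)
Fixpoint greedy_sum (n : nat) (x : T) : R :=
  if n is m.+1 then
    (greedy_sum m x + (if ((greedy_sum m x + harmonic m)%:E <= f x)%E
                       then harmonic m else 0))%R
  else 0%R.

Definition greedy_set n := [set x | (greedy_sum n x + harmonic n)%:E <= f x].

Lemma greedy_sumE n x :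
  \sum_(0 <= k < n) (harmonic k * \1_(greedy_set k) x)%:E = (greedy_sum n x)%:E.
Proof.
elim: n => [|n IH]; first by rewrite big_nil.
rewrite big_nat_recr//= IH EFinD indicE; congr (_ + _%:E).
have [h|h] := boolP (_ <= f x).
  by rewrite mem_set// mulr1.
by rewrite memNset ?mulr0//; exact/negP.
Qed.

Lemma greedy_sum_le n x : 0 <= f x -> (greedy_sum n x)%:E <= f x.
Proof. by move=> f0; elim: n => [//|n IH] /=; case: ifP => // _; rewrite addr0. Qed.

(** Were the sum [r] smaller than [f x], every late enough term, being smaller than
the gap, would be added, and the harmonic series would be bounded. *)
Lemma greedy_series x : 0 <= f x ->
  f x = \sum_(n <oo) (harmonic n * \1_(greedy_set n) x)%:E.
Proof.
move=> f0; pose u n : \bar R := (harmonic n * \1_(greedy_set n) x)%:E.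
rewrite -[RHS]/(\sum_(n <oo) u n).
have u0 n : 0 <= u n by rewrite lee_fin mulr_ge0// harmonic_ge0.
apply/le_anti/andP; split; last first.
  apply: lime_le; first exact: is_cvg_nneseries.
  by apply: nearW => n; rewrite greedy_sumE greedy_sum_le.
rewrite leNgt; set l := (X in X < _); apply/negP => lf.
have sl n : (greedy_sum n x)%:E <= l.
  by rewrite -greedy_sumE; apply: nneseries_lim_ge => k _ _; exact: u0.
have l0 : 0 <= l by apply: nneseries_ge0 => n _ _; exact: u0.
have lfin : l \is a fin_num by rewrite ge0_fin_numE// (lt_le_trans lf)// leey.
move: lf sl; rewrite -(fineK lfin); set r := fine l => lf sl.
have [e e0 ef] : exists2 e : R, (0 < e)%R & (r + e)%:E <= f x.
  case: (f x) lf => [y| |]// lf.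
  - by exists (y - r)%R; [rewrite subr_gt0|rewrite subrKC].
  - by exists 1%R => //; rewrite leey.
have [N _ NP] : \forall n \near \oo, (harmonic n < e)%R.
  have /cvgrPdist_lt/(_ _ e0) := @cvg_harmonic R.
  by apply: filterS => n; rewrite sub0r normrN ger0_norm// harmonic_ge0.
pose h : R^nat := series (@harmonic R).
(* From rank N on, the greedy sums grow like the harmonic series. *)
have E m : (h (N + m)%N = h N + greedy_sum (N + m)%N x - greedy_sum N x)%R.
  elim: m => [|m IH]; first by rewrite addn0 addrK.
  rewrite addnS [LHS]/h/series/= big_nat_recr//= -[X in (X + _)%R]/(h (N + m)%N) IH.
  rewrite ifT; first by rewrite addrAC; congr (_ - _)%R; rewrite addrA. 
  rewrite (le_trans _ ef)// lee_fin lerD//; first by rewrite -lee_fin.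
  by rewrite ltW// NP//= leq_addr.
apply: (@dvg_harmonic R); apply: nondecreasing_is_cvgn.
  by apply/nondecreasing_seqP => n; rewrite [leRHS]/series/= big_nat_recr//= lerDl harmonic_ge0.
exists (h N + r)%R => _ [n _ <-]; rewrite -/(h n).
have : (h n <= h (N + n)%N)%R.
  elim: N {NP E} => [//|N IH]; apply: le_trans IH _.
  by rewrite [leRHS]/h/series/= big_nat_recr//= lerDl harmonic_ge0.
have := sl (N + n)%N; rewrite lee_fin.
have : (0 <= greedy_sum N x)%R.
  by rewrite -lee_fin -greedy_sumE sume_ge0// => k _; exact: u0.
rewrite E; lra.
Qed.
End greedy.

Lemma ge0_series_indic d (T : measurableType d) {R : realType} (f : T -> \bar R) :
  measurable_fun [set: T] f -> (forall x, 0 <= f x) ->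
  exists2 S : (set T)^nat, forall n, measurable (S n) &
    forall x, f x = \sum_(n <oo) (harmonic n * \1_(S n) x)%:E.
Proof.
move=> mf f0; exists (greedy_set f); last by move=> x; exact: greedy_series.
have mS n : measurable_fun [set: T] (greedy_sum f n) -> measurable (greedy_set f n).
  move=> ms; rewrite -[greedy_set f n]setTI; apply: measurable_lee => //.
  by apply/measurable_EFinP; exact: measurable_funD.
move=> n; apply: (mS); elim: n => [|n IH] /=; first exact: measurable_cst.
apply: measurable_funD => //.
rewrite (_ : (fun _ => _) = (fun x => harmonic n * \1_(greedy_set f n) x)%R).
  by apply: measurable_funM => //; exact/measurable_indic/mS.
apply/funext => x; rewrite indicE.
have [h|h] := boolP (_ <= f x).
  by rewrite mem_set// mulr1.
by rewrite memNset ?mulr0//; exact/negP.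
Qed.

(** * Conditional expectation of nonnegative functions *)

Section sub_sigma_algebra.
Context d (X : measurableType d) {R : realType}.
Variables (mu : {measure set X -> \bar R}) (A : set (set X)).
Hypothesis subA : sub_sigma_algebra A.
Local Notation XA := (g_sigma_algebraType A).
Implicit Types f g h : X -> \bar R.

Lemma sub_measurableE (B : set XA) : measurable B = A B.
Proof.
by rewrite -[RHS](_ : <<s A >> B = _) // sigma_algebra_id//; case: subA.
Qed.

Lemma sub_measurable B : A B -> d.-measurable B.
Proof. by case: subA => _; exact. Qed.

Lemma sub_measurableT (B : set XA) : measurable B -> d.-measurable B.
Proof. by rewrite sub_measurableE; exact: sub_measurable. Qed.

Lemma sub_measurable_fun d' (Y : measurableType d') (g : X -> Y) :
  measurable_fun [set: XA] (g : XA -> Y) -> measurable_fun [set: X] g.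
Proof. by move=> mg _ B mB; apply: sub_measurableT; exact: mg. Qed.

Lemma sub_measurable_funS d' (Y : measurableType d') (g : X -> Y) (B : set X) :
  measurable_fun [set: XA] (g : XA -> Y) -> measurable_fun B g.
Proof. by move=> mg; apply: measurable_funTS; exact: sub_measurable_fun. Qed.

Section sigma_finite.
Hypothesis sfA : sigma_finite [set: XA] (mu : set XA -> \bar R).

Lemma sub_exhaustion : exists F : (set X)^nat,
  [/\ forall n, A (F n), forall n, mu (F n) < +oo & forall x, exists n, F n x].
Proof.
case: sfA => F FT /all_and2[mF Foo]; exists F; split => //.
- by move=> n; rewrite -sub_measurableE.
- move=> x; have : [set: X] x by [].
  by rewrite [X in X x](FT : [set: X] = _) => -[n _]; exists n.
Qed.

(** The finite subset property, in contrapositive form. *)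
Lemma null_if_finite_null S : A S ->
  (forall B, A B -> B `<=` S -> mu B < +oo -> mu B = 0) -> mu S = 0.
Proof.
move=> AS H; have [F [AF Foo FT]] := sub_exhaustion.
have ASF n : A (S `&` F n).
  by rewrite -sub_measurableE; apply: measurableI; rewrite sub_measurableE.
apply/negligibleP; first exact: sub_measurable.
apply: (@negligibleS _ _ _ _ (\bigcup_n (S `&` F n))).
  by move=> x Sx; have [n Fx] := FT x; exists n.
apply: negligible_bigcup => n; apply/negligibleP; first exact: sub_measurable.
apply: H => //; rewrite (le_lt_trans _ (Foo n))// le_measure ?inE//;
  exact: sub_measurable.
Qed.

(** If [g2 < g1] on a non-null set, then some set of A of finite nonzero measure
carries [g2 <= n] and [g2 + 1/(n+1) <= g1]; integrating over it, where [g2] has a finite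
integral, contradicts the hypothesis. *)
Lemma ae_le_of_integrals g1 g2 :
  measurable_fun [set: XA] (g1 : XA -> \bar R) ->
  measurable_fun [set: XA] (g2 : XA -> \bar R) ->
  (forall x, 0 <= g1 x) -> (forall x, 0 <= g2 x) ->
  (forall B, A B -> mu B < +oo ->
    \int[mu]_(x in B) g1 x <= \int[mu]_(x in B) g2 x) ->
  {ae mu, forall x, g1 x <= g2 x}.
Proof.
move=> mg1 mg2 g10 g20 H.
pose S n := [set x | g2 x <= n%:R%:E] `&` [set x | g2 x + n.+1%:R^-1%:E <= g1 x].
have mS n : measurable (S n : set XA).
  apply: measurableI; rewrite -[X in measurable X]setTI.
  - exact: emeasurable_fun_infty_c.
  - apply: measurable_lee => //.
    exact: emeasurable_funD.
have AS n : A (S n) by rewrite -sub_measurableE.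
have S0 n : mu (S n) = 0.
  apply: null_if_finite_null => // B AB BS Boo.
  have mB := sub_measurable AB.
  have fin2 : \int[mu]_(x in B) g2 x \is a fin_num.
    rewrite ge0_fin_numE; last by apply: integral_ge0.
    rewrite (@le_lt_trans _ _ (\int[mu]_(x in B) cst n%:R%:E x))//; last first.
      by rewrite integral_cst// lte_mul_pinfty// ?lee_fin.
    apply: ge0_le_integral => //; first exact: sub_measurable_funS.
    by move=> x /BS[].
  have := H _ AB Boo.
  have : \int[mu]_(x in B) (g2 x + n.+1%:R^-1%:E) <= \int[mu]_(x in B) g1 x.
    apply: ge0_le_integral => //.
    - by move=> x _; rewrite adde_ge0// lee_fin.
    - by apply: emeasurable_funD => //; exact: sub_measurable_funS.
    - exact: sub_measurable_funS.
    - by move=> x /BS[].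
  rewrite ge0_integralD//; [|exact: sub_measurable_funS].
  rewrite integral_cst// => h1 h2.
  have := le_trans h1 h2; rewrite -[leRHS]adde0 leeD2lE// => h3.
  apply/eqP; rewrite eq_le measure_ge0 andbT.
  by rewrite pmule_rle0 in h3.
apply: (@negligibleS _ _ _ _ (\bigcup_n S n)); last first.
  by apply: negligible_bigcup => n; apply/(negligibleP _ (sub_measurable (AS n))); exact: S0.
move=> x /= /negP; rewrite -ltNge => lt21.
have g2fin : g2 x \is a fin_num by rewrite ge0_fin_numE// (lt_le_trans lt21)// leey.
have [n1 n1P] : exists n : nat, g2 x <= n%:R%:E.
  exists (Num.bound (fine (g2 x))); rewrite -[leLHS]fineK// lee_fin.
  by rewrite ltW// archi_boundP// fine_ge0.
have [n2 n2P] : exists n : nat, g2 x + n.+1%:R^-1%:E <= g1 x.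
  case g1x : (g1 x) lt21 => [r| |]; last 2 first.
  - by exists 0%N; rewrite leey.
  - by rewrite ltNge leNye.
  rewrite -[g2 x]fineK// lte_fin => lt21.
  have [k kP] := ltr_add_invr lt21.
  by exists k; rewrite -EFinD lee_fin ltW.
exists (maxn n1 n2) => //; split => /=.
  by rewrite (le_trans n1P)// lee_fin ler_nat leq_maxl.
apply: le_trans n2P; rewrite leeD2l// lee_fin lef_pV2 ?posrE//.
by rewrite ler_nat ltnS leq_maxr.
Qed.

Lemma is_condexp_unique f1 f2 g1 g2 : is_condexp mu A f1 g1 ->
  is_condexp mu A f2 g2 ->
  (forall B, A B -> \int[mu]_(x in B) f1 x = \int[mu]_(x in B) f2 x) ->
  {ae mu, forall x, g1 x = g2 x}.
Proof.
move=> [mg1 g10 fg1] [mg2 g20 fg2] f12.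
have l12 : {ae mu, forall x, g1 x <= g2 x}.
  by apply: ae_le_of_integrals => // B AB _; rewrite -fg1// -fg2// f12.
have l21 : {ae mu, forall x, g2 x <= g1 x}.
  by apply: ae_le_of_integrals => // B AB _; rewrite -fg1// -fg2// f12.
by apply: filterS2 l12 l21 => x h1 h2; apply/le_anti; rewrite h1 h2.
Qed.

Lemma is_condexp_nneseries (f_ g_ : nat -> X -> \bar R) :
  (forall n, measurable_fun [set: X] (f_ n)) -> (forall n x, 0 <= f_ n x) ->
  (forall n, is_condexp mu A (f_ n) (g_ n)) ->
  is_condexp mu A (fun x => \sum_(n <oo) f_ n x) (fun x => \sum_(n <oo) g_ n x).
Proof.
move=> mf f0 fg; split.
- apply: (@ge0_emeasurable_sum _ XA _ _ g_ xpredT) => [n x _ _|n _].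
    by case: (fg n).
  by case: (fg n).
- by move=> x; apply: nneseries_ge0 => n _ _; case: (fg n).
move=> B AB; have mB := sub_measurable AB.
rewrite !integral_nneseries//.
- by apply: eq_eseriesr => n _; case: (fg n) => _ _; apply.
- by move=> n; apply: sub_measurable_funS; case: (fg n).
- by move=> n x _; case: (fg n).
- by move=> n; exact: measurable_funTS.
Qed.

(** Radon-Nikodym on the measurable space of A, for the restriction of [mu] and the
finite measure with density [f]; both measures have to be rebuilt there. *)
Lemma is_condexp_integrable f : measurable_fun [set: X] f ->
  (forall x, 0 <= f x) -> \int[mu]_x f x < +oo ->
  exists g, is_condexp mu A f g.
Proof.
move=> mf f0 foo.
have mid : measurable_fun [set: X] (idfun : X -> XA).
  by move=> _ B mB; rewrite setTI; exact: sub_measurableT.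
have [m mE] : exists m : {sigma_finite_measure set XA -> \bar R},
    forall B, m B = mu B.
  have sadd : semi_sigma_additive (mu : set XA -> \bar R).
    move=> F mF tF mUF; apply: measure_semi_sigma_additive => //.
    - by move=> i; exact: sub_measurableT.
    - exact: sub_measurableT.
  pose m0 : {measure set XA -> \bar R} :=
    HB.pack_for {measure set XA -> \bar R} (mu : set XA -> \bar R)
    (isMeasure.Build _ XA R (mu : set XA -> \bar R) (measure0 mu) (measure_ge0 mu) sadd).
  have sfm0 : sigma_finite [set: XA] m0 by [].
  by exists (HB.pack_for {sigma_finite_measure set XA -> \bar R}
    (Measure.sort m0)
    (isSFinite.Build _ XA R (Measure.sort m0) (sfinite_measure_sigma_finite sfm0))
    (isSigmaFinite.Build _ XA R (Measure.sort m0) sfm0)).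
pose nu0 (B : set XA) : \bar R := \int[mu]_(x in B) f x.
have [nu nuE] : exists nu : {finite_measure set XA -> \bar R},
    forall B, nu B = \int[mu]_(x in B) f x.
  have nu00 : nu0 set0 = 0 by rewrite /nu0 integral_set0.
  have nu0ge0 B : 0 <= nu0 B by apply: integral_ge0.
  have nu0sadd : semi_sigma_additive nu0.
    move=> F mF tF mUF; apply: (semi_sigma_additive_nng_induced mf f0) => //.
    - by move=> i; exact: sub_measurableT.
    - exact: sub_measurableT.
    pose nu1 : {measure set XA -> \bar R} :=
    HB.pack_for {measure set XA -> \bar R} nu0
      (isMeasure.Build _ XA R nu0 nu00 nu0ge0 nu0sadd).
  have nu1fin : fin_num_fun nu1.
    move=> B mB; rewrite ge0_fin_numE// (le_lt_trans _ foo)//.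
    by apply: ge0_subset_integral => //; exact: sub_measurableT.
  have sfnu1 : sigma_finite [set: XA] nu1.
    by apply: fin_num_fun_sigma_finite => //; rewrite /= nu00.
  by exists (HB.pack_for {finite_measure set XA -> \bar R}
    (Measure.sort nu1)
    (isSFinite.Build _ XA R (Measure.sort nu1) (sfinite_measure_sigma_finite sfnu1))
    (isSigmaFinite.Build _ XA R (Measure.sort nu1) sfnu1)
    (isFinite.Build _ XA R (Measure.sort nu1) nu1fin)).
have numu : nu `<< m.
  apply/null_content_dominatesP => B mB; rewrite nuE => mB0.
  have B0 : mu B = 0 by rewrite -mE.
  by apply: null_set_integral => //; [exact: sub_measurableT|exact: measurable_funTS].
have [g [g0 _ ig gE]] := radon_nikodym_sigma_finite numu.
have mg : measurable_fun [set: XA] (g : XA -> \bar R) by exact: measurable_int ig.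
exists g; split => // B AB.
have mB : measurable (B : set XA) by rewrite sub_measurableE.
have := gE _ mB; rewrite nuE /nu0 => ->.
rewrite -[RHS](@ge0_integral_pushforward _ _ X XA R idfun mid mu B g) //; last first.
  exact: measurable_funTS.
by apply: eq_measure_integral => C mC _; exact: mE.
Qed.

End sigma_finite.
End sub_sigma_algebra.

(** The factor [y] may be [+oo], with the convention that [+oo * 0 = 0]. *)
Lemma ge0_nneseriesZl {R : realType} (y : \bar R) (f : (\bar R)^nat) :
  0 <= y -> (forall n, 0 <= f n) ->
  \sum_(n <oo) y * f n = y * \sum_(n <oo) f n.
Proof.
case: y => [r _ f0|_ f0|//]; first exact: nneseriesZl.
have [f00|/existsNP[n fn]] := pselect (forall n, f n = 0).
  rewrite !eseries0 ?mule0// => n _ _; by rewrite f00 ?mule0.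
have fn0 : 0 < f n by rewrite lt_neqAle f0 andbT eq_sym; exact/eqP.
have le_term (h : (\bar R)^nat) : (forall n, 0 <= h n) -> h n <= \sum_(n <oo) h n.
  move=> h0; apply: le_trans (nneseries_lim_ge n.+1 _) => //.
  by rewrite big_nat_recr//= leeDr// sume_ge0.
rewrite gt0_mulye ?(lt_le_trans fn0) ?le_term//.
apply/eqP; rewrite -leye_eq -[leLHS](gt0_mulye fn0).
by apply: (le_term (fun n => +oo * f n)) => k; rewrite mule_ge0.
Qed.

Section condexp_theory.
Context d (X : measurableType d) {R : realType}.
Variables (mu : {measure set X -> \bar R}) (A : set (set X)).
Hypothesis subA : sub_sigma_algebra A.
Local Notation XA := (g_sigma_algebraType A).
Hypothesis sfA : sigma_finite [set: XA] (mu : set XA -> \bar R).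
Implicit Types f g h : X -> \bar R.

Lemma is_condexpZ (c : R) f g : (0 <= c)%R -> measurable_fun [set: X] f ->
  (forall x, 0 <= f x) -> is_condexp mu A f g ->
  is_condexp mu A (fun x => c%:E * f x) (fun x => c%:E * g x).
Proof.
move=> c0 mf f0 [mg g0 fg]; split.
- exact: (@emeasurable_funM _ XA).
- by move=> x; rewrite mule_ge0// lee_fin.
move=> B AB; have mB := sub_measurable subA AB.
rewrite !ge0_integralZl_EFin//; first by rewrite fg.
- exact: (sub_measurable_funS subA).
- exact: measurable_funTS.
Qed.

Lemma is_condexpD f1 f2 g1 g2 :
  measurable_fun [set: X] f1 -> (forall x, 0 <= f1 x) ->
  measurable_fun [set: X] f2 -> (forall x, 0 <= f2 x) ->
  is_condexp mu A f1 g1 -> is_condexp mu A f2 g2 ->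
  is_condexp mu A (fun x => f1 x + f2 x) (fun x => g1 x + g2 x).
Proof.
move=> mf1 f10 mf2 f20 [mg1 g10 fg1] [mg2 g20 fg2]; split.
- exact: (@emeasurable_funD _ XA).
- by move=> x; rewrite adde_ge0.
move=> B AB; have mB := sub_measurable subA AB.
rewrite !ge0_integralD//; first by rewrite fg1// fg2.
- exact: (sub_measurable_funS subA).
- exact: (sub_measurable_funS subA).
- exact: measurable_funTS.
- exact: measurable_funTS.
Qed.

Lemma is_condexp_indicM S f g : A S -> is_condexp mu A f g ->
  is_condexp mu A (fun x => (\1_S x)%:E * f x) (fun x => (\1_S x)%:E * g x).
Proof.
move=> AS [mg g0 fg]; split.
- apply: (@emeasurable_funM _ XA) => //; apply/measurable_EFinP.
  by apply: (@measurable_indic _ XA); rewrite (sub_measurableE subA).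
- by move=> x; rewrite mule_ge0// lee_fin.
have H k B : \int[mu]_(x in B) ((\1_S x)%:E * k x) = \int[mu]_(x in B `&` S) k x.
  rewrite integral_mkcondr epatch_indic.
  by apply: eq_integral => x _; rewrite muleC.
move=> B AB; rewrite !H fg// -(sub_measurableE subA)//.
by apply: measurableI; rewrite (sub_measurableE subA).
Qed.

(** Expand [f] as a series of indicators, and each indicator along a disjoint
exhaustion by sets of A of finite measure: the pieces are integrable. *)
Lemma is_condexp_exists f : measurable_fun [set: X] f ->
  (forall x, 0 <= f x) -> exists g, is_condexp mu A f g.
Proof.
move=> mf f0; have [F [AF Foo FT]] := sub_exhaustion subA sfA.
have mF n : d.-measurable (F n) by exact: (sub_measurable subA).
have mE n : d.-measurable (seqDU F n).
  by apply: measurableD => //; exact: bigsetU_measurable.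
have [S mS fE] := ge0_series_indic mf f0.
have exI k (B : set X) : d.-measurable B ->
    exists g, is_condexp mu A (fun x => (\1_(B `&` seqDU F k) x)%:E) g.
  move=> mB; have mBE : d.-measurable (B `&` seqDU F k) by exact: measurableI.
  apply: (is_condexp_integrable subA sfA) => //.
  - by apply/measurable_EFinP; exact: measurable_indic.
  - by rewrite integral_indic// setIT (le_lt_trans _ (Foo k))// le_measure ?inE// => x [_ []].
have exI' (B : set X) : d.-measurable B ->
    exists g, is_condexp mu A (fun x => (\1_B x)%:E) g.
  move=> mB; have /choice[g_ gP] := fun k => exI k B mB.
  exists (fun x => \sum_(k <oo) g_ k x).
  have -> : (fun x => (\1_B x)%:E) =
      (fun x => \sum_(k <oo) (\1_(B `&` seqDU F k) x)%:E) :> (X -> \bar R).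
    apply/funext => x; rewrite -indic_bigcup; last exact/trivIset_setIl/trivIset_seqDU.
    rewrite -setI_bigcupr -seqDU_bigcup_eq (_ : \bigcup_n F n = setT) ?setIT//.
    by apply/seteqP; split => // y _; have [n Fy] := FT y; exists n.
  apply: (is_condexp_nneseries subA) => //.
  move=> n; apply/measurable_EFinP; apply: measurable_indic.
  exact: measurableI.
have /choice[g_ gP] := fun n => exI' _ (mS n).
exists (fun x => \sum_(n <oo) (harmonic n)%:E * g_ n x).
have -> : f = (fun x => \sum_(n <oo) (harmonic n)%:E * (\1_(S n) x)%:E).
  by apply/funext => x; rewrite fE.
have mI n : measurable_fun [set: X] (fun x => (\1_(S n) x)%:E : \bar R).
  by apply/measurable_EFinP; exact: measurable_indic.
apply: (is_condexp_nneseries subA) => //.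
- by move=> n; exact: emeasurable_funM.
- by move=> n x; apply: mule_ge0; rewrite lee_fin ?harmonic_ge0.
- by move=> n; apply: is_condexpZ => //; exact: harmonic_ge0.
Qed.

Lemma condexpP f : measurable_fun [set: X] f -> (forall x, 0 <= f x) ->
  is_condexp mu A f (condexp mu A f).
Proof.
by move=> mf f0; rewrite /condexp; have [g gP] := is_condexp_exists mf f0; apply: xgetPex; exists g.
Qed.

Lemma measurable_condexp f :
  measurable_fun [set: XA] (condexp mu A f : XA -> \bar R).
Proof.
by rewrite /condexp; case: xgetP => [g _ []|_]//; exact: measurable_cst.
Qed.

Lemma condexp_ge0 f x : 0 <= condexp mu A f x.
Proof. by rewrite /condexp; case: xgetP => [g _ []|_]. Qed.

Lemma condexp_unique f g : measurable_fun [set: X] f -> (forall x, 0 <= f x) ->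
  is_condexp mu A f g -> {ae mu, forall x, condexp mu A f x = g x}.
Proof. by move=> mf f0 fg; apply: (is_condexp_unique subA sfA (condexpP mf f0) fg). Qed.

Lemma condexp_le f1 f2 :
  measurable_fun [set: X] f1 -> (forall x, 0 <= f1 x) ->
  measurable_fun [set: X] f2 -> (forall x, f1 x <= f2 x) ->
  {ae mu, forall x, condexp mu A f1 x <= condexp mu A f2 x}.
Proof.
move=> mf1 f10 mf2 f12; have f20 x : 0 <= f2 x by exact: le_trans (f12 x).
have [mg1 g10 fg1] := condexpP mf1 f10; have [mg2 g20 fg2] := condexpP mf2 f20.
apply: (ae_le_of_integrals subA sfA mg1 mg2 g10 g20) => B AB _.
have mB := sub_measurable subA AB; rewrite -fg1// -fg2//.
by apply: ge0_le_integral => //; exact: measurable_funTS.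
Qed.

Lemma condexpD f1 f2 :
  measurable_fun [set: X] f1 -> (forall x, 0 <= f1 x) ->
  measurable_fun [set: X] f2 -> (forall x, 0 <= f2 x) ->
  {ae mu, forall x, condexp mu A (fun x => f1 x + f2 x) x =
    condexp mu A f1 x + condexp mu A f2 x}.
Proof.
move=> mf1 f10 mf2 f20; apply: condexp_unique.
- exact: emeasurable_funD.
- by move=> x; rewrite adde_ge0.
- by apply: is_condexpD => //; exact: condexpP.
Qed.

(** Pulling out an A-measurable factor: true for indicators of sets of A by
restricting the domain of integration, hence for series of their multiples. *)
Lemma condexpM (p : X -> R) f : measurable_fun [set: XA] (p : XA -> R) ->
  (forall x, 0 <= p x)%R ->
  measurable_fun [set: X] f -> (forall x, 0 <= f x) ->
  {ae mu, forall x, condexp mu A (fun x => (p x)%:E * f x) x =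
    (p x)%:E * condexp mu A f x}.
Proof.
move=> mp p0 mf f0.
have mp' : measurable_fun [set: XA] (EFin \o p : XA -> \bar R).
  exact/measurable_EFinP.
have [S mS pE] := ge0_series_indic mp' p0.
have AS n : A (S n) by rewrite -(sub_measurableE subA).
have E k : (forall x, 0 <= k x) -> (fun x => (p x)%:E * k x) =
    (fun x => \sum_(n <oo) (harmonic n)%:E * ((\1_(S n) x)%:E * k x)).
  move=> k0; apply/funext => x; rewrite -[(p x)%:E]/((EFin \o p) x) pE.
  rewrite muleC -ge0_nneseriesZl//; last first.
    by move=> n; rewrite lee_fin mulr_ge0// harmonic_ge0.
  by apply: eq_eseriesr => n _; rewrite EFinM [LHS]muleC muleA.
apply: condexp_unique.
- by apply: emeasurable_funM => //; exact: (sub_measurable_fun subA mp').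
- by move=> x; rewrite mule_ge0// lee_fin.
rewrite !E//; last exact: condexp_ge0.
have mI n : measurable_fun [set: X] (fun x => (\1_(S n) x)%:E : \bar R).
  by apply/measurable_EFinP; apply: measurable_indic; exact: (sub_measurable subA).
apply: (is_condexp_nneseries subA) => //.
- by move=> n; do 2 apply: emeasurable_funM => //.
- by move=> n x; rewrite !mule_ge0 ?lee_fin ?harmonic_ge0.
move=> n; apply: is_condexpZ => //.
- exact: harmonic_ge0.
- exact: emeasurable_funM.
- by move=> x; rewrite mule_ge0// lee_fin.
- by apply: is_condexp_indicM => //; exact: condexpP.
Qed.
End condexp_theory.

(** * Conditional expectation of complex functions *)

Section complex_valued.
Context {R : realType}.
Implicit Types z : R[i].

Lemma cmodulusE z :
  cmodulus z = Num.sqrt (complex.Re z ^+ 2 + complex.Im z ^+ 2)%R.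
Proof. by case: z. Qed.

Lemma cmodulus_ge0 z : (0 <= cmodulus z)%R.
Proof. by rewrite cmodulusE sqrtr_ge0. Qed.

Lemma sqr_cmodulus z : (cmodulus z ^+ 2 = complex.Re z ^+ 2 + complex.Im z ^+ 2)%R.
Proof. by rewrite cmodulusE sqr_sqrtr// addr_ge0// sqr_ge0. Qed.

Lemma cmodulusM z z' : cmodulus (z * z')%R = (cmodulus z * cmodulus z')%R.
Proof. exact: Normc.normcM. Qed.

Lemma cmodulus_real (p : R) : cmodulus p%:C%C = `|p|%R.
Proof. by rewrite cmodulusE/= expr0n/= addr0 sqrtr_sqr. Qed.

Lemma Re_le_cmodulus z : (`|complex.Re z| <= cmodulus z)%R.
Proof.
by rewrite cmodulusE -sqrtr_sqr ler_sqrt ?lerDl ?sqr_ge0// addr_ge0// sqr_ge0.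
Qed.

Lemma Im_le_cmodulus z : (`|complex.Im z| <= cmodulus z)%R.
Proof.
by rewrite cmodulusE -sqrtr_sqr ler_sqrt ?lerDr ?sqr_ge0// addr_ge0// sqr_ge0.
Qed.

(** Cauchy-Schwarz in the plane. *)
Lemma dot_le_cmodulus z z' :
  (complex.Re z * complex.Re z' + complex.Im z * complex.Im z'
    <= cmodulus z * cmodulus z')%R.
Proof.
rewrite (le_trans (ler_norm _))// -[leRHS]ger0_norm ?mulr_ge0 ?cmodulus_ge0//.
rewrite -ler_sqr ?nnegrE ?normr_ge0// !real_normK ?num_real//.
rewrite exprMn !sqr_cmodulus; move: (complex.Re _) (complex.Re _) (complex.Im _) (complex.Im _).
move=> a b c e; rewrite -subr_ge0.
rewrite (_ : _ - _ = (a * e - c * b) ^+ 2)%R; last by ring.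
exact: sqr_ge0.
Qed.

Lemma measurable_cmodulus d (T : measurableType d) (f : T -> R[i]) :
  cmeasurable f -> measurable_fun [set: T] (fun x => cmodulus (f x)).
Proof.
move=> [mRe mIm].
rewrite (_ : (fun _ => _) = @Num.sqrt R \o
   (fun x => (complex.Re (f x) ^+ 2 + complex.Im (f x) ^+ 2)%R)); last first.
  by apply/funext => x; rewrite cmodulusE.
apply: measurableT_comp; first by apply: continuous_measurable_fun; exact: sqrt_continuous.
by apply: measurable_funD; exact: measurable_funX.
Qed.

Lemma measurable_ecmodulus d (T : measurableType d) (f : T -> R[i]) :
  cmeasurable f -> measurable_fun [set: T] (fun x => (cmodulus (f x))%:E).
Proof. by move=> mf; apply/measurable_EFinP; exact: measurable_cmodulus. Qed.

Lemma cmeasurableM d (T : measurableType d) (f g : T -> R[i]) :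
  cmeasurable f -> cmeasurable g -> cmeasurable (fun x => (f x * g x)%R).
Proof.
move=> [mf1 mf2] [mg1 mg2]; split.
  rewrite (_ : _ \o _ = (fun x => complex.Re (f x) * complex.Re (g x) -
    complex.Im (f x) * complex.Im (g x))%R); last first.
    by apply/funext => x /=; case: (f x) (g x) => ? ? [].
  by apply: measurable_funB; exact: measurable_funM.
rewrite (_ : _ \o _ = (fun x => complex.Re (f x) * complex.Im (g x) +
  complex.Im (f x) * complex.Re (g x))%R); last first.
  by apply/funext => x /=; case: (f x) (g x) => ? ? [].
by apply: measurable_funD; exact: measurable_funM.
Qed.

Lemma cmeasurable_real d (T : measurableType d) (p : T -> R) :
  measurable_fun [set: T] p -> cmeasurable (fun x => (p x)%:C%C).
Proof. by move=> mp; split => //; exact: measurable_cst. Qed.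

End complex_valued.

Section ccondexp_theory.
Context d (X : measurableType d) {R : realType}.
Variables (mu : {measure set X -> \bar R}) (A : set (set X)).
Hypothesis subA : sub_sigma_algebra A.
Local Notation XA := (g_sigma_algebraType A).
Hypothesis sfA : sigma_finite [set: XA] (mu : set XA -> \bar R).
Local Notation E := (condexp mu A).

Lemma measurable_rcondexp (h : X -> R) :
  measurable_fun [set: XA] (rcondexp mu A h : XA -> R).
Proof.
apply: (@measurable_funB _ XA) => //.
  by apply: (@measurableT_comp _ _ _ XA) => //; exact: measurable_condexp.
by apply: (@measurableT_comp _ _ _ XA) => //; exact: measurable_condexp.
Qed.

Lemma cmeasurable_ccondexp (h : X -> R[i]) :
  @cmeasurable R _ XA (ccondexp mu A h).
Proof. by split; exact: measurable_rcondexp. Qed.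

Lemma sub_cmeasurable_ccondexp (h : X -> R[i]) :
  cmeasurable (ccondexp mu A h : X -> R[i]).
Proof.
by split; apply: (sub_measurable_fun subA); exact: measurable_rcondexp.
Qed.

Lemma rcondexpM (p : X -> R) (h : X -> R) :
  measurable_fun [set: XA] (p : XA -> R) -> (forall x, 0 <= p x)%R ->
  measurable_fun [set: X] h ->
  {ae mu, forall x, rcondexp mu A (fun x => p x * h x)%R x =
    (p x * rcondexp mu A h x)%R}.
Proof.
move=> mp p0 mh.
have Ep : (EFin \o (fun x => p x * h x)^\+)%R = (fun x => (p x)%:E * (EFin \o h^\+)%R x).
  by apply/funext => x /=; rewrite -EFinM /funrpos maxr_pMr// mulr0.
have En : (EFin \o (fun x => p x * h x)^\-)%R = (fun x => (p x)%:E * (EFin \o h^\-)%R x).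
  by apply/funext => x /=; rewrite -EFinM /funrneg maxr_pMr// mulr0 mulrN.
have mhp : measurable_fun [set: X] (EFin \o h^\+)%R.
  by apply/measurable_EFinP; exact: measurable_funrpos.
have mhn : measurable_fun [set: X] (EFin \o h^\-)%R.
  by apply/measurable_EFinP; exact: measurable_funrneg.
have fineMl (c : R) e : (0 <= c)%R -> fine (c%:E * e) = (c * fine e)%R.
  rewrite le_eqVlt => /predU1P[<-|c0]; first by rewrite mul0e mul0r.
  case: e => [r| |]//=; first by rewrite gt0_muley ?lte_fin//= mulr0.
  by rewrite gt0_muleNy ?lte_fin//= mulr0.
have := condexpM subA sfA mp p0 mhp; have := condexpM subA sfA mp p0 mhn.
move=> /(_ (fun x => funrneg_ge0 h x)) Hn /(_ (fun x => funrpos_ge0 h x)) Hp.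
apply: filterS2 Hn Hp => x hn hp.
by rewrite /rcondexp Ep En hp hn !fineMl// mulrBr.
Qed.

Lemma ccondexpM (p : X -> R) (h : X -> R[i]) :
  measurable_fun [set: XA] (p : XA -> R) -> (forall x, 0 <= p x)%R ->
  cmeasurable h ->
  {ae mu, forall x, ccondexp mu A (fun x => (p x)%:C%C * h x)%R x =
    ((p x)%:C%C * ccondexp mu A h x)%R}.
Proof.
move=> mp p0 [mRe mIm].
have ERe : @complex.Re R \o (fun x => (p x)%:C%C * h x)%R = (fun x => p x * (@complex.Re R \o h) x)%R.
  by apply/funext => x /=; case: (h x) => a b /=; rewrite mul0r subr0.
have EIm : @complex.Im R \o (fun x => (p x)%:C%C * h x)%R = (fun x => p x * (@complex.Im R \o h) x)%R.
  by apply/funext => x /=; case: (h x) => a b /=; rewrite mul0r addr0.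
apply: filterS2 (rcondexpM mp p0 mRe) (rcondexpM mp p0 mIm) => x hr hi.
rewrite /ccondexp ERe EIm hr hi.
move: (rcondexp mu A (@complex.Re R \o h) x) (rcondexp mu A (@complex.Im R \o h) x) => a b.
by apply/eqP; rewrite eq_complex/= !mul0r subr0 addr0 !eqxx.
Qed.
End ccondexp_theory.

Section modulus_inequality.
Context d (X : measurableType d) {R : realType}.
Variables (mu : {measure set X -> \bar R}) (A : set (set X)).
Hypothesis subA : sub_sigma_algebra A.
Local Notation XA := (g_sigma_algebraType A).
Hypothesis sfA : sigma_finite [set: XA] (mu : set XA -> \bar R).
Local Notation E := (condexp mu A).

Lemma condexp0 : {ae mu, forall x, E (cst 0) x = 0}.
Proof.
have H : is_condexp mu A (cst 0) (cst 0) by split => //; exact: measurable_cst.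
exact: (condexp_unique subA sfA (measurable_cst _) (fun=> lexx _) H).
Qed.

(** Linear combinations with A-measurable coefficients. Functions and coefficients are
nonnegative, so that all conditional expectations involved make sense even when
infinite. *)
Lemma condexp_lincomb (s : seq ((X -> R) * (X -> R))) :
  (forall pf, List.In pf s -> 
    [/\ measurable_fun [set: XA] (pf.1 : XA -> R), forall x, (0 <= pf.1 x)%R,
      measurable_fun [set: X] pf.2 & forall x, (0 <= pf.2 x)%R]) ->
  [/\ measurable_fun [set: X] (fun x => \sum_(pf <- s) (pf.1 x * pf.2 x)%:E),
    forall x, 0 <= \sum_(pf <- s) (pf.1 x * pf.2 x)%:E &
   {ae mu, forall x, E (fun x => \sum_(pf <- s) (pf.1 x * pf.2 x)%:E) x =
    \sum_(pf <- s) (pf.1 x)%:E * E (EFin \o pf.2) x}].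
Proof.
elim: s => [_|[p f] s IH H].
  have -> : (fun x => \sum_(pf <- [::]) (pf.1 x * pf.2 x)%:E) = cst 0 :> (X -> \bar R).
    by apply/funext => x; rewrite big_nil.
  split; [exact: measurable_cst|by move=> x; rewrite big_nil|].
  by apply: filterS condexp0 => x ->; rewrite big_nil.
have [mp p0 mf f0] := H _ (or_introl erefl).
have [|ms s0 Es] := IH; first by move=> pf pfs; apply: H; right.
have Ec : (fun x => \sum_(pf <- (p, f) :: s) (pf.1 x * pf.2 x)%:E) =
    (fun x => (p x)%:E * (EFin \o f) x + \sum_(pf <- s) (pf.1 x * pf.2 x)%:E).
  by apply/funext => x; rewrite big_cons.
rewrite Ec.
have mf' : measurable_fun [set: X] (EFin \o f) by exact/measurable_EFinP.
have mpf : measurable_fun [set: X] (fun x => (p x)%:E * (EFin \o f) x).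
  apply: emeasurable_funM => //; apply/measurable_EFinP.
  exact: (sub_measurable_fun subA mp).
have pf0 x : 0 <= (p x)%:E * (EFin \o f) x by rewrite mule_ge0// lee_fin.
split; [exact: emeasurable_funD|by move=> x; rewrite big_cons; apply: adde_ge0; [exact: pf0|exact: s0]|].
have H1 := condexpD subA sfA mpf pf0 ms s0.
have H2 := condexpM subA sfA mp p0 mf' f0.
by apply: filterS3 Es H1 H2 => x h1 h2 h3; rewrite h2 h3 h1 big_cons.
Qed.

(** A pointwise bound [a u + b v <= r m] with A-measurable [a], [b], [r] passes to
conditional expectations. Since E is only additive on nonnegative functions, all
factors are split into positive and negative parts and the negative products moved
to the other side; where E(m) is finite they can be moved back. *)
Lemma condexp_dot_le (a b r u v m : X -> R) :
  measurable_fun [set: XA] (a : XA -> R) -> measurable_fun [set: XA] (b : XA -> R) ->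
  measurable_fun [set: XA] (r : XA -> R) -> (forall x, 0 <= r x)%R ->
  measurable_fun [set: X] u -> measurable_fun [set: X] v ->
  measurable_fun [set: X] m ->
  (forall x, `|u x| <= m x)%R -> (forall x, `|v x| <= m x)%R ->
  (forall x, a x * u x + b x * v x <= r x * m x)%R ->
  {ae mu, forall x, E (EFin \o m) x < +oo ->
    (a x * rcondexp mu A u x + b x * rcondexp mu A v x
      <= r x * fine (E (EFin \o m) x))%R}.
Proof.
move=> ma mb mr r0 mu_ mv mm um vm dot.
have m0 x : (0 <= m x)%R by exact: le_trans (um x).
have mup : measurable_fun [set: X] (u^\+)%R by exact: measurable_funrpos.
have mun : measurable_fun [set: X] (u^\-)%R by exact: measurable_funrneg.
have mvp : measurable_fun [set: X] (v^\+)%R by exact: measurable_funrpos.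
have mvn : measurable_fun [set: X] (v^\-)%R by exact: measurable_funrneg.
have map_ : measurable_fun [set: XA] (a^\+ : XA -> R)%R by exact: (@measurable_funrpos _ XA).
have man_ : measurable_fun [set: XA] (a^\- : XA -> R)%R by exact: (@measurable_funrneg _ XA).
have mbp : measurable_fun [set: XA] (b^\+ : XA -> R)%R by exact: (@measurable_funrpos _ XA).
have mbn : measurable_fun [set: XA] (b^\- : XA -> R)%R by exact: (@measurable_funrneg _ XA).
have p0 (k : X -> R) x : (0 <= k^\+ x)%R by exact: funrpos_ge0.
have n0 (k : X -> R) x : (0 <= k^\- x)%R by exact: funrneg_ge0.
pose s1 := [:: (a^\+, u^\+); (a^\-, u^\-); (b^\+, v^\+); (b^\-, v^\-)]%R.
pose s2 := [:: (r, m); (a^\+, u^\-); (a^\-, u^\+); (b^\+, v^\-); (b^\-, v^\+)]%R.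
have [|ms1 s10 E1] := @condexp_lincomb s1.
  move=> pf /= [<-|[<-|[<-|[<-|//]]]]; split => // x; by [exact: p0|exact: n0].
have [|ms2 s20 E2] := @condexp_lincomb s2.
  by move=> pf /= [<-|[<-|[<-|[<-|[<-|//]]]]]; split => // x; by [exact: r0|exact: m0|exact: p0|exact: n0].
have pnE (k : X -> R) x : k x = (k^\+ x - k^\- x)%R by rewrite -[in LHS](funrposBneg k).
have rearrange (c1 c2 d1 d2 w1 w2 z1 z2 q : R) :
    ((c1 - c2) * (w1 - w2) + (d1 - d2) * (z1 - z2) <= q)%R =
    (c1 * w1 + (c2 * w2 + (d1 * z1 + (d2 * z2 + 0)))
      <= q + (c1 * w2 + (c2 * w1 + (d1 * z2 + (d2 * z1 + 0)))))%R.
  by rewrite -subr_ge0 -[RHS]subr_ge0; congr (0 <= _)%R; ring.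
have s12 x : \sum_(pf <- s1) (pf.1 x * pf.2 x)%:E <= \sum_(pf <- s2) (pf.1 x * pf.2 x)%:E.
  rewrite !big_cons !big_nil /= -!EFinD lee_fin -rearrange -!pnE.
  exact: dot.
have E12 := condexp_le subA sfA ms1 s10 ms2 s12.
have fin_le (k : X -> R) : measurable_fun [set: X] k ->
    (forall x, 0 <= k x <= m x)%R ->
    {ae mu, forall x, E (EFin \o k) x <= E (EFin \o m) x}.
  move=> mk km; apply: condexp_le => //.
  - exact/measurable_EFinP.
  - by move=> x; rewrite lee_fin; case/andP: (km x).
  - exact/measurable_EFinP.
  - by move=> x; rewrite lee_fin; case/andP: (km x).
have pn_le (k : X -> R) : (forall x, `|k x| <= m x)%R ->
    (forall x, 0 <= k^\+ x <= m x)%R /\ (forall x, 0 <= k^\- x <= m x)%R.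
  move=> km; split => x; have := km x; rewrite ler_norml ?p0 ?n0 => /andP[k1 k2].
    by rewrite /funrpos ge_max k2 m0.
  by rewrite /funrneg ge_max m0 lerNl k1.
have [ump umn] := pn_le _ um; have [vmp vmn] := pn_le _ vm.
have Fu : {ae mu, forall x, E (EFin \o u^\+)%R x <= E (EFin \o m) x /\
    E (EFin \o u^\-)%R x <= E (EFin \o m) x}.
  by apply: filterS2 (fin_le _ mup ump) (fin_le _ mun umn).
have Fv : {ae mu, forall x, E (EFin \o v^\+)%R x <= E (EFin \o m) x /\
    E (EFin \o v^\-)%R x <= E (EFin \o m) x}.
  by apply: filterS2 (fin_le _ mvp vmp) (fin_le _ mvn vmn).
have {E1 E2}E12 : {ae mu, forall x, \sum_(pf <- s1) (pf.1 x)%:E * E (EFin \o pf.2) x <=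
    \sum_(pf <- s2) (pf.1 x)%:E * E (EFin \o pf.2) x}.
  by apply: filterS3 E1 E2 E12 => x <- <-.
apply: filterS3 Fu Fv E12 => x [up un] [vp vn].
rewrite !big_cons !big_nil /= => + moo; rewrite /rcondexp.
have fins z : 0 <= z -> z <= E (EFin \o m) x -> z = (fine z)%:E.
  by move=> z0 ze; rewrite fineK// ge0_fin_numE// (le_lt_trans ze).
rewrite (fins _ (condexp_ge0 _ _ _ _) up) (fins _ (condexp_ge0 _ _ _ _) un)
  (fins _ (condexp_ge0 _ _ _ _) vp) (fins _ (condexp_ge0 _ _ _ _) vn)
  (fins _ (condexp_ge0 _ _ _ _) (lexx _)).
by rewrite -!EFinM -!EFinD lee_fin -rearrange -(pnE a) -(pnE b).
Qed.

(** With [z := ccondexp h], the scalar product of [z] and [h] is at most [|z| |h|];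
taking conditional expectations gives |z|^2 <= |z| E(|h|). *)
Lemma cmodulus_ccondexp_le (h : X -> R[i]) : cmeasurable h ->
  {ae mu, forall x, (cmodulus (ccondexp mu A h x))%:E <=
    E (fun x => (cmodulus (h x))%:E) x}.
Proof.
move=> mh; have [mRe mIm] := mh.
pose r x := cmodulus (ccondexp mu A h x).
have mr : measurable_fun [set: XA] (r : XA -> R).
  by apply: measurable_cmodulus; exact: cmeasurable_ccondexp.
have := condexp_dot_le (@measurable_rcondexp _ _ _ mu A (@complex.Re R \o h))
  (@measurable_rcondexp _ _ _ mu A (@complex.Im R \o h)) mr
  (fun x => cmodulus_ge0 _) mRe mIm (measurable_cmodulus mh)
  (fun x => Re_le_cmodulus _) (fun x => Im_le_cmodulus _)
  (fun x => dot_le_cmodulus (ccondexp mu A h x) (h x)).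
move=> H; apply: filterS H => x H.
have [moo|] := ltP (E (EFin \o (fun x => cmodulus (h x))) x) +oo; last first.
  by rewrite leye_eq => /eqP moo; rewrite (_ : E _ x = +oo)// leey.
have {H} := H moo.
rewrite -!expr2 -[X in (X <= _)%R](sqr_cmodulus (ccondexp mu A h x)) -/(r x) expr2 => H.
rewrite -[leRHS](@fineK _ (E (EFin \o (fun x => cmodulus (h x))) x)); last first.
  by rewrite ge0_fin_numE// condexp_ge0.
rewrite lee_fin.
have : (0 <= r x)%R by exact: cmodulus_ge0.
rewrite le_eqVlt => /predU1P[r0|rp]; last by rewrite -(ler_pM2l rp).
by rewrite -/(r x) -r0 fine_ge0// condexp_ge0.
Qed.

Lemma cmodulus_ccondexp_real (h : X -> R) : measurable_fun [set: X] h ->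
  (forall x, 0 <= h x)%R ->
  forall x, cmodulus (ccondexp mu A (fun x => (h x)%:C%C) x) = `|rcondexp mu A h x|%R.
Proof.
move=> mh h0 x; rewrite /ccondexp.
have Im0 : ((@complex.Im R \o (fun x => (h x)%:C%C))^\+ =
    (@complex.Im R \o (fun x => (h x)%:C%C))^\-)%R.
  by apply/funext => y; rewrite /funrpos /funrneg /= oppr0.
have -> : rcondexp mu A (@complex.Im R \o (fun x => (h x)%:C%C)) x = 0%R.
  by rewrite /rcondexp Im0 subrr.
by rewrite cmodulusE /= expr0n addr0 sqrtr_sqr.
Qed.

Lemma rcondexp_ge0 (h : X -> R) : measurable_fun [set: X] h ->
  (forall x, 0 <= h x)%R ->
  {ae mu, forall x, rcondexp mu A h x = fine (E (EFin \o h) x)}.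
Proof.
move=> mh h0.
apply: filterS condexp0 => x; rewrite /rcondexp.
have -> : (EFin \o h^\-)%R = cst 0.
  by apply/funext => y; rewrite /funrneg /= max_r// oppr_le0.
have -> : (EFin \o h^\+)%R = EFin \o h.
  by apply/funext => y; rewrite /funrpos /= max_l.
by move=> ->; rewrite subr0.
Qed.
End modulus_inequality.

(** * Modulars and essential suprema *)

Section orlicz_theory.
Context d (X : measurableType d) {R : realType}.
Variables (mu : {measure set X -> \bar R}) (Phi : R -> R).
Hypothesis yPhi : young Phi.
Implicit Types f : X -> R[i].

Lemma measurable_modular (k : R) f : cmeasurable f ->
  measurable_fun [set: X] (fun x => (Phi (k * cmodulus (f x)))%:E).
Proof.
move=> mf; apply/measurable_EFinP.
apply: measurableT_comp; first exact: measurable_young.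
by apply: measurable_funM => //; exact: measurable_cmodulus.
Qed.

Lemma measurable_modular_div (k : R) f : cmeasurable f ->
  measurable_fun [set: X] (fun x => (Phi (cmodulus (f x) / k))%:E).
Proof.
move=> mf; under eq_fun do rewrite mulrC.
exact: measurable_modular.
Qed.

Lemma luxemburg_le (k : R) f : (0 < k)%R ->
  \int[mu]_x (Phi (cmodulus (f x) / k))%:E <= 1 -> luxemburg mu Phi f <= k%:E.
Proof. by move=> k0 fk; apply: ereal_inf_lbound; exists k. Qed.

(** A strict inequality provides an admissible constant smaller than [k], and the
modular decreases as the constant grows. *)
Lemma modular_le1 (k : R) f : cmeasurable f -> (0 < k)%R ->
  luxemburg mu Phi f < k%:E -> \int[mu]_x (Phi (cmodulus (f x) / k))%:E <= 1.
Proof.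
move=> mf k0 /ereal_inf_lt[_ [l [l0 fl] <-]]; rewrite lte_fin => lk.
apply: le_trans fl; apply: ge0_le_integral => //.
- by move=> x _; rewrite lee_fin young_ge0.
- exact: measurable_modular_div.
- exact: measurable_modular_div.
- move=> x _; rewrite lee_fin; apply: young_le => //.
    by rewrite divr_ge0 ?cmodulus_ge0 ?ltW.
  by rewrite ler_wpM2l ?cmodulus_ge0// lef_pV2 ?posrE// ltW.
Qed.

Lemma modular_orlicz f : cmeasurable f ->
  \int[mu]_x (Phi (cmodulus (f x)))%:E < +oo -> orlicz mu Phi f.
Proof.
by move=> mf foo; split => //; exists 1%R => //; under eq_integral do rewrite mul1r.
Qed.

Lemma bounded_modular (T : (X -> R[i]) -> X -> R[i]) :
  orlicz_bounded mu Phi T ->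
  exists2 M : R, (0 < M)%R & forall f, cmeasurable f ->
    \int[mu]_x (Phi (cmodulus (f x)))%:E <= 1 ->
    \int[mu]_x (Phi (cmodulus (T f x) / M))%:E <= 1.
Proof.
(* M + 1 rather than M, to have a strict inequality and a positive constant *)
move=> [Torl [M M0 TM]]; exists (M + 1)%R; first by rewrite ltr_wpDl.
move=> f mf f1.
have orlf : orlicz mu Phi f.
  by apply: modular_orlicz => //; rewrite (le_lt_trans f1)// ltry.
apply: modular_le1; first by case: (Torl _ orlf).
  by rewrite ltr_wpDl.
apply: le_lt_trans (TM _ orlf) _; apply: (@le_lt_trans _ _ (M%:E * 1)).
  rewrite lee_wpmul2l ?lee_fin//; apply: luxemburg_le => //.
  by under eq_integral do rewrite divr1.
by rewrite mule1 lte_fin ltrDl.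
Qed.

End orlicz_theory.

Section integral_support.
Context d (X : measurableType d) {R : realType}.
Variable mu : {measure set X -> \bar R}.

Lemma integral_support (B : set X) (g : X -> \bar R) :
  (forall x, ~ B x -> g x = 0) -> \int[mu]_x g x = \int[mu]_(x in B) g x.
Proof.
move=> gB; rewrite [RHS]integral_mkcond; apply: eq_integral => x _.
rewrite patchE; case: ifPn => // /negP xB; apply: gB => Bx.
by apply: xB; exact: mem_set.
Qed.

Lemma Linfty_norm_le (g : X -> \bar R) (c : R) : (0 <= c)%R ->
  {ae mu, forall x, `|g x| <= c%:E} -> 'N[mu]_+oo[g] <= c%:E.
Proof.
by move=> c0 gc; rewrite unlock; case: ifPn => // _; apply/ess_supP.
Qed.

(** On a space of measure 0 the norm is 0 by definition, but there every property holds
almost everywhere. *)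
Lemma ae_le_Linfty_norm (g : X -> \bar R) :
  {ae mu, forall x, `|g x| <= 'N[mu]_+oo[g]}.
Proof.
rewrite unlock; case: ifPn => [_|mu0]; first exact: ess_sup_ge.
exists [set: X]; split => //; apply/eqP; rewrite eq_le measure_ge0 andbT.
by rewrite leNgt.
Qed.
End integral_support.

(** * Boundedness of the conditional expectation of the multiplier *)

Section multiplier.
Context d (X : measurableType d) {R : realType}.
Variables (mu : {measure set X -> \bar R}) (A : set (set X)).
Hypothesis subA : sub_sigma_algebra A.
Local Notation XA := (g_sigma_algebraType A).
Hypothesis sfA : sigma_finite [set: XA] (mu : set XA -> \bar R).
Local Notation E := (condexp mu A).
Variable Phi : R -> R.
Hypothesis yPhi : young Phi.
Variable u : X -> R[i].
Hypothesis mu_u : cmeasurable u.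
Local Notation T := (condexp_mul mu A u).

(** E(|u| 1_B) = 1_B E(|u|), and countably many sets B cover the space. *)
Lemma conditionable_of_finite_sets :
  (forall B, A B -> mu B < +oo ->
    conditionable mu A (fun x => u x * (\1_B x)%:C%C)%R) ->
  conditionable mu A u.
Proof.
move=> H; split => //; have [F [AF Foo FT]] := sub_exhaustion subA sfA.
have Hn n : {ae mu, forall x, F n x -> E (fun x => (cmodulus (u x))%:E) x < +oo}.
  have [_ Hoo] := H _ (AF n) (Foo n).
  have mI : measurable_fun [set: XA] (\1_(F n) : XA -> R).
    by apply: measurable_indic; rewrite (sub_measurableE subA).
  have HM := condexpM subA sfA mI (fun x => ler0n R (x \in F n)) (measurable_ecmodulus mu_u)
    (fun x => cmodulus_ge0 _).
  apply: filterS2 Hoo HM => x + + Fx.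
  rewrite (_ : (fun x => (cmodulus (u x * _)%R)%:E) =
    (fun x => (\1_(F n) x)%:E * (cmodulus (u x))%:E)); last first.
    by apply/funext => y; rewrite cmodulusM cmodulus_real ger0_norm// mulrC.
  by move=> h1 h2; move: h1; rewrite h2 /= indicE mem_set// mul1e.
have /ae_foralln := Hn.
by apply: filterS => x Hx; have [n Fx] := FT x; exact: Hx Fx.
Qed.

Lemma modular_indic (B : set X) (t : R) : d.-measurable B -> (0 <= t)%R ->
  \int[mu]_x (Phi (cmodulus (t * \1_B x)%:C%C))%:E = (Phi t)%:E * mu B.
Proof.
move=> mB t0; rewrite (@integral_support _ _ _ _ B); last first.
  by move=> x nBx; rewrite indicE memNset// mulr0 cmodulus_real normr0 young0.
rewrite -integral_cst//; apply: eq_integral => x xB.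
by rewrite indicE xB mulr1 cmodulus_real ger0_norm.
Qed.

(** The test function is [t 1_B] with [Phi t = 1 / mu B], of modular 1; on a set B
where |E(u)| > 2 M its image would have modular at least 2 after division by M. *)
Lemma bounded_ccondexp : orlicz_bounded mu Phi T ->
  exists2 M : R, (0 < M)%R &
    {ae mu, forall x, (cmodulus (ccondexp mu A u x) <= M)%R}.
Proof.
move=> /(bounded_modular yPhi)[M M0 TM]; exists (2 * M)%R; first by rewrite mulr_gt0.
pose e x := cmodulus (ccondexp mu A u x).
have me : measurable_fun [set: XA] (e : XA -> R).
  by apply: measurable_cmodulus; exact: cmeasurable_ccondexp.
pose S := [set x | (2 * M < e x)%R].
have mS : measurable (S : set XA).
  rewrite (_ : S = [set: X] `&` e @^-1` `](2 * M)%R, +oo[); first exact: me.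
  by rewrite setTI; apply/seteqP; split => x /=; rewrite in_itv/= andbT.
have AS : A S by rewrite -(sub_measurableE subA).
suff S0 : mu S = 0.
  exists S; split => //; first exact: (sub_measurable subA).
  by move=> x /= /negP; rewrite -ltNge.
apply: (null_if_finite_null subA sfA AS) => B AB BS Boo.
have mB := sub_measurable subA AB.
apply/eqP/negPn/negP => B0.
have Bfin : mu B \is a fin_num by rewrite ge0_fin_numE.
have b0 : (0 < fine (mu B))%R by rewrite fine_gt0// Boo andbT lt_neqAle eq_sym B0 measure_ge0.
move: Bfin b0 => /fineK; set b := fine (mu B) => bE b0.
have [t t0 tb] := young_surj yPhi (ltW (etrans (invr_gt0 b) b0)).
have mp : measurable_fun [set: XA] (fun x => t * \1_B x : R)%R.
  apply: (@measurable_funM _ XA) => //.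
  by apply: (@measurable_indic _ XA); rewrite (sub_measurableE subA).
have p0 x : (0 <= t * \1_B x)%R by rewrite mulr_ge0.
pose f x := ((t * \1_B x)%:C%C : R[i]).
have mf : cmeasurable f by apply: cmeasurable_real; exact: (sub_measurable_fun subA mp).
have := TM _ mf; rewrite modular_indic// tb -bE -EFinM mulVf ?lt0r_neq0// => /(_ (lexx _)).
apply/negP; rewrite -ltNge (@lt_le_trans _ _ (\int[mu]_(x in B) (2 * b^-1)%:E))//.
  rewrite integral_cst// -bE -EFinM mulfVK ?lt0r_neq0// lte_fin; lra.
have mTf : cmeasurable (T f) by exact: sub_cmeasurable_ccondexp.
have mTM := measurable_modular_div yPhi M mTf.
apply: (@le_trans _ _ (\int[mu]_(x in B) (Phi (cmodulus (T f x) / M))%:E)); last first.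
  by apply: ge0_subset_integral => // x _; rewrite lee_fin young_ge0.
apply: ae_ge0_le_integral => //.
- by move=> x _; rewrite lee_fin mulr_ge0// invr_ge0 ltW.
- by move=> x _; rewrite lee_fin young_ge0.
- exact: measurable_funTS.
have := ccondexpM subA sfA mp p0 mu_u.
rewrite (_ : (fun x => (t * \1_B x)%:C%C * u x)%R = (fun x => u x * f x)%R); last first.
  by apply/funext => x; rewrite mulrC.
move=> H; apply: filterS H => x Tfx Bx.
rewrite lee_fin /condexp_mul Tfx cmodulusM cmodulus_real ger0_norm//.
rewrite indicE mem_set// mulr1 -/(e x) -tb.
apply: le_trans (young_scale_ge yPhi _ _) _; first lra.
have Sx := BS _ Bx; apply: young_le => //; first by rewrite mulr_ge0.
by rewrite mulrC -mulrA ler_wpM2l// ler_pdivlMr// ltW.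
Qed.

End multiplier.

(** * Boundedness of the conditional expectation of Psi(u) *)

Section dual_point.
Context {R : realType} (Phi : R -> R).
Hypothesis yPhi : young Phi.
Local Notation Psi := (complementary Phi).
Hypothesis yPsi : young Psi.

(** Half of the direction that norms [z] in the duality between Phi and Psi:
its product with [z] is Psi(|z|) / 2, and Phi does not exceed that value at it. *)
Definition dual_point (z : R[i]) : R[i] :=
  ((Psi (cmodulus z) / (2 * cmodulus z ^+ 2))%:C%C * conjc z)%R.

Lemma mul_dual_point z : (z * dual_point z)%R = (Psi (cmodulus z) / 2)%:C%C.
Proof.
have [z0|z0] := eqVneq (cmodulus z) 0%R.
  by move/Normc.eq0_normc: z0 => ->; rewrite mul0r /cmodulus Normc.normc0 young0// mul0r.
rewrite /dual_point mulrCA.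
have -> : (z * conjc z = (cmodulus z ^+ 2)%:C%C)%R.
  rewrite sqr_cmodulus; case: z {z0} => a b; apply/eqP; rewrite eq_complex/=.
  by apply/andP; split; apply/eqP; ring.
rewrite -rmorphM/=; congr (_%:C%C)%R.
by field.
Qed.

Lemma young_dual_point z : (Phi (cmodulus (dual_point z)) <= Psi (cmodulus z) / 2)%R.
Proof.
have m0 := cmodulus_ge0 z.
have -> : cmodulus (dual_point z) = (Psi (cmodulus z) / (2 * cmodulus z))%R.
  rewrite /dual_point cmodulusM cmodulus_real ger0_norm; last first.
    by apply: divr_ge0; [exact: young_ge0|rewrite mulr_ge0// sqr_ge0].
  have -> : cmodulus (conjc z) = cmodulus z by case: (z) => a b; rewrite !cmodulusE/= sqrrN.
  have [->|z0] := eqVneq (cmodulus z) 0%R; first by rewrite !mulr0 invr0 mulr0.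
  by field.
have [->|z0] := eqVneq (cmodulus z) 0%R.
  by rewrite mulr0 invr0 mulr0 !young0// mul0r.
apply: young_half_complementary => //; first by rewrite lt_neqAle eq_sym z0.
exact: young_gt0.
Qed.

Lemma cmeasurable_dual_point d (X : measurableType d) (u : X -> R[i]) :
  cmeasurable u -> cmeasurable (fun x => dual_point (u x)).
Proof.
move=> mu_u; apply: cmeasurableM; last first.
  have [m1 m2] := mu_u; split.
    by rewrite (_ : _ \o _ = @complex.Re R \o u)//; apply/funext => x /=; case: (u x).
  rewrite (_ : _ \o _ = -%R \o (@complex.Im R \o u))%R.
    by apply: measurableT_comp => //; exact: oppr_measurable.
  by apply/funext => x /=; case: (u x).
have mm := measurable_cmodulus mu_u.
apply: cmeasurable_real; apply: measurable_funM.
  by apply: measurableT_comp => //; exact: measurable_young.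
rewrite (_ : (fun x => _) = (fun y : R => powR y (-1)) \o (fun x => 2 * cmodulus (u x) ^+ 2)%R).
  apply: measurableT_comp; first exact: measurable_powR.
  by apply: measurable_funM => //; exact: measurable_funX.
by apply/funext => x /=; rewrite powR_inv1// mulr_ge0// sqr_ge0.
Qed.

End dual_point.

Section complementary_bound.
Context d (X : measurableType d) {R : realType}.
Variables (mu : {measure set X -> \bar R}) (A : set (set X)).
Hypothesis subA : sub_sigma_algebra A.
Local Notation XA := (g_sigma_algebraType A).
Hypothesis sfA : sigma_finite [set: XA] (mu : set XA -> \bar R).
Local Notation E := (condexp mu A).
Variable Phi : R -> R.
Hypothesis yPhi : young Phi.
Local Notation Psi := (complementary Phi).
Hypothesis yPsi : young Psi.
Variable u : X -> R[i].
Hypothesis mu_u : cmeasurable u.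
Local Notation T := (condexp_mul mu A u).

Let D (n : nat) := [set x | (cmodulus (u x) <= n%:R)%R].

Let mD n : d.-measurable (D n).
Proof.
rewrite (_ : D n = [set: X] `&` (fun x => cmodulus (u x)) @^-1` `]-oo, n%:R]).
  exact: measurable_cmodulus.
by rewrite setTI; apply/seteqP; split => x /=; rewrite in_itv.
Qed.

Let h n x := (\1_(D n) x * Psi (cmodulus (u x)))%R.

Let h0 n x : (0 <= h n x)%R.
Proof. by rewrite mulr_ge0// young_ge0. Qed.

Let mPsiu : measurable_fun [set: X] (fun x => Psi (cmodulus (u x))).
Proof.
apply: measurableT_comp; first exact: measurable_young.
exact: measurable_cmodulus.
Qed.

Let mh n : measurable_fun [set: X] (h n).
Proof. by apply: measurable_funM => //; exact: measurable_indic. Qed.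

Let mhE n : measurable_fun [set: X] (EFin \o h n).
Proof. exact/measurable_EFinP. Qed.

Let h_le n x : (h n x <= Psi n%:R)%R.
Proof.
rewrite /h indicE; have [xD|] := boolP (x \in D n); last first.
  by rewrite mul0r young_ge0.
by rewrite mul1r young_le ?cmodulus_ge0//; move: xD; rewrite inE.
Qed.

Let int_h_lty n B : d.-measurable B -> mu B < +oo ->
  \int[mu]_(x in B) (h n x)%:E < +oo.
Proof.
move=> mB Boo; rewrite (@le_lt_trans _ _ (\int[mu]_(x in B) (Psi n%:R)%:E))//.
  apply: ge0_le_integral => //; [by move=> x _; exact: h0|exact: (measurable_funTS (mhE n))|].
  by move=> x _; rewrite lee_fin.
by rewrite integral_cst// lte_mul_pinfty// ?lee_fin ?young_ge0.
Qed.

Let f (B : set X) (t : R) n x : R[i] :=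
  ((t * \1_(B `&` D n) x)%:C%C * dual_point Phi (u x))%R.

Let mf B t n : d.-measurable B -> cmeasurable (f B t n).
Proof.
move=> mB; apply: cmeasurableM; last exact: cmeasurable_dual_point.
apply: cmeasurable_real; apply: measurable_funM => //.
by apply: measurable_indic; exact: measurableI.
Qed.

Let uf B t n : (fun x => (u x * f B t n x)%R) =
  (fun x => ((t / 2 * \1_B x * h n x)%R%:C)%C).
Proof.
apply/funext => x; rewrite /f mulrCA mul_dual_point// -rmorphM/=.
by rewrite /h indicI /=; congr (_%:C%C)%R; field.
Qed.

Let cond_uf B t n : A B -> (0 <= t)%R ->
  {ae mu, forall x, cmodulus (T (f B t n) x) =
     (t / 2 * \1_B x * fine (E (EFin \o h n) x))%R}.
Proof.
move=> AB t0; have mB := sub_measurable subA AB.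
have mp : measurable_fun [set: XA] (fun x => t / 2 * \1_B x : R)%R.
  apply: (@measurable_funM _ XA) => //.
  by apply: (@measurable_indic _ XA); rewrite (sub_measurableE subA).
have p0 x : (0 <= t / 2 * \1_B x)%R by rewrite !mulr_ge0.
have mph : measurable_fun [set: X] (fun x => t / 2 * \1_B x * h n x)%R.
  by apply: measurable_funM => //; exact: (sub_measurable_fun subA mp).
have ph0 x : (0 <= t / 2 * \1_B x * h n x)%R by rewrite mulr_ge0.
have H1 := rcondexpM subA sfA mp p0 (mh n).
have H2 := rcondexp_ge0 subA sfA (mh n) (h0 n).
apply: filterS2 H1 H2 => x e1 e2.
rewrite /condexp_mul uf cmodulus_ccondexp_real// e1 e2 ger0_norm//.
by rewrite mulr_ge0// fine_ge0// condexp_ge0.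
Qed.

(** Delta' separates the constant [t] from the dual point. *)
Let modular_f (c t : R) B n : d.-measurable B -> (0 <= t)%R -> (0 < c)%R ->
  (forall x y, 0 <= x -> 0 <= y -> Phi (x * y) <= c * (Phi x * Phi y))%R ->
  \int[mu]_x (Phi (cmodulus (f B t n x)))%:E <=
  (c * Phi t / 2)%:E * \int[mu]_(x in B) (h n x)%:E.
Proof.
move=> mB t0 c0 cP.
have cPhi0 : (0 <= c * Phi t / 2)%R by rewrite !mulr_ge0 ?(young_ge0 yPhi) ?(ltW c0).
rewrite (@integral_support _ _ _ _ B); last first.
  move=> x nBx; rewrite /f indicE memNset; last by case.
  by rewrite mulr0 mul0r /cmodulus Normc.normc0 young0.
rewrite -ge0_integralZl_EFin//;
  [|by move=> x _; exact: h0|exact: (measurable_funTS (mhE n))].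
apply: ge0_le_integral => //.
- by move=> x _; rewrite lee_fin young_ge0.
- apply: measurable_funTS; under eq_fun do rewrite -[cmodulus _]mul1r.
  by apply: measurable_modular => //; exact: mf.
- by apply: emeasurable_funM => //; exact: (measurable_funTS (mhE n)).
move=> x Bx; rewrite -EFinM lee_fin /f /h indicI /= [\1_B x]indicE mem_set// mul1r.
rewrite indicE; case: (x \in D n); last first.
  by rewrite mulr0 mul0r /cmodulus Normc.normc0 young0// mul0r mulr0.
rewrite mulr1 mul1r cmodulusM cmodulus_real ger0_norm//.
apply: le_trans (cP _ _ t0 (cmodulus_ge0 _)) _.
rewrite (_ : c * Phi t / 2 * _ = c * (Phi t * (Psi (cmodulus (u x)) / 2)))%R; last by field.
apply: ler_wpM2l; first exact: ltW.
apply: ler_wpM2l; first exact: young_ge0.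
exact: young_dual_point.
Qed.

(** On a set B of positive finite measure where [S := E(h n)] exceeds 2 M / l, normalize
[t] so that the test function has modular at most 1. The superlinear growth of [Phi],
applied with [z := S / (2 M)], bounds the modular of its image divided by M from below
by the integral over B of [(2 / s) S], which is 2. *)
Lemma condexp_truncated_le (c M l : R) n : (0 < c)%R ->
  (forall x y, 0 <= x -> 0 <= y -> Phi (x * y) <= c * (Phi x * Phi y))%R ->
  (0 < M)%R -> (forall f, cmeasurable f ->
    \int[mu]_x (Phi (cmodulus (f x)))%:E <= 1 ->
    \int[mu]_x (Phi (cmodulus (T f x) / M))%:E <= 1) ->
  (0 < l)%R -> (forall t z, 0 <= t -> l^-1 <= z ->
    (2 * M * c) * z * Phi t <= Phi (z * t))%R ->
  {ae mu, forall x, E (EFin \o h n) x <= (2 * M / l)%:E}.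
Proof.
move=> c0 cP M0 TM l0 lP; set L := (2 * M / l)%R.
have L0 : (0 < L)%R by rewrite divr_gt0// mulr_gt0.
set S := E (EFin \o h n).
have [mS S0 intS] := condexpP subA sfA (mhE n) (h0 n).
pose Z := [set x | L%:E < S x].
have AZ : A Z.
  rewrite -(sub_measurableE subA) -[Z]setTI.
  exact: (@emeasurable_fun_o_infty _ XA).
suff Z0 : mu Z = 0.
  exists Z; split => //; first exact: (sub_measurable subA).
  by move=> x /= /negP; rewrite -ltNge.
apply: (null_if_finite_null subA sfA AZ) => B AB BZ Boo.
have mB := sub_measurable subA AB.
apply/eqP/negPn/negP => B0.
have Bp : 0 < mu B by rewrite lt_neqAle eq_sym B0 measure_ge0.
have sfin : \int[mu]_(x in B) (h n x)%:E \is a fin_num.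
  rewrite ge0_fin_numE; [exact: int_h_lty|apply: integral_ge0 => x _; exact: h0].
have sp : 0 < \int[mu]_(x in B) (h n x)%:E.
  rewrite -[X in 0 < X]/(\int[mu]_(x in B) (EFin \o h n) x) intS//.
  rewrite (@lt_le_trans _ _ (\int[mu]_(x in B) L%:E))//.
    by rewrite integral_cst// mule_gt0.
  apply: ge0_le_integral => //.
  - by move=> x _; rewrite lee_fin ltW.
  - exact: (sub_measurable_funS subA).
  - by move=> x /BZ/ltW.
have := sp; move: (sfin) => /fineK; set s := fine _ => sE.
rewrite -sE lte_fin => s0.
have [t t0 tE] := young_surj yPhi (ltW (divr_gt0 (ltr0n R 2 : 0 < 2)%R (mulr_gt0 c0 s0))).
(* t solves c * Phi t * s / 2 = 1, where s is the integral of h n over B *)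
have m1 : \int[mu]_x (Phi (cmodulus (f B t n x)))%:E <= 1.
  apply: le_trans (modular_f n mB t0 c0 cP) _.
  rewrite -sE -EFinM lee_fin tE le_eqVlt; apply/orP; left; apply/eqP.
  by field; rewrite !lt0r_neq0.
have := TM _ (mf t n mB) m1; apply/negP; rewrite -ltNge.
have mTf : cmeasurable (T (f B t n)) by exact: sub_cmeasurable_ccondexp.
have mTM := measurable_modular_div yPhi M mTf.
apply: (@lt_le_trans _ _ (\int[mu]_(x in B) (Phi (cmodulus (T (f B t n) x) / M))%:E)); last first.
  by apply: ge0_subset_integral => // x _; rewrite lee_fin young_ge0.
apply: (@lt_le_trans _ _ (\int[mu]_(x in B) ((2 / s)%:E * S x))).
  have s20 : (0 <= 2 / s)%R by rewrite divr_ge0// ltW.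
  rewrite ge0_integralZl_EFin//; last exact: (sub_measurable_funS subA).
  rewrite -intS// -[X in _ * X]/(\int[mu]_(x in B) (h n x)%:E) -sE -EFinM divfK ?lt0r_neq0//.
  by rewrite lte_fin; lra.
have Sfin : {ae mu, forall x, S x < +oo}.
  have : {ae mu, forall x, S x <= (Psi n%:R)%:E}.
    apply: (ae_le_of_integrals subA sfA) => //.
    - by move=> x; rewrite lee_fin young_ge0.
    - move=> C AC _; have mC := sub_measurable subA AC; rewrite -intS//.
      apply: ge0_le_integral => //; [by move=> y _; exact: h0|exact: (measurable_funTS (mhE n))|].
      by move=> x _; rewrite lee_fin.
  by apply: filterS => x h1; rewrite (le_lt_trans h1)// ltry.
apply: ae_ge0_le_integral => //.
- by move=> x _; rewrite mule_ge0// lee_fin divr_ge0// ltW.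
- by apply: emeasurable_funM => //; exact: (sub_measurable_funS subA).
- by move=> x _; rewrite lee_fin young_ge0.
- exact: measurable_funTS.
apply: filterS2 Sfin (cond_uf n AB t0) => x Soo Tfx Bx.
have Sxfin : S x \is a fin_num by rewrite ge0_fin_numE.
have : L%:E < S x := BZ _ Bx.
rewrite -(fineK Sxfin) lte_fin -EFinM lee_fin Tfx -/S.
rewrite indicE mem_set// mulr1; set z := fine (S x) => Lz.
rewrite (_ : t / 2 * z / M = z / (2 * M) * t)%R; last by field; exact: lt0r_neq0.
apply: le_trans (lP _ _ t0 _).
  rewrite tE le_eqVlt; apply/orP; left; apply/eqP.
  by field; rewrite !lt0r_neq0.
rewrite ler_pdivlMr ?mulr_gt0// mulrC; exact: ltW.
Qed.

(** The bound for the truncations is uniform in n; monotone convergence over each set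
of A removes the truncation. *)
Lemma bounded_condexp_complementary : Delta' Phi -> orlicz_bounded mu Phi T ->
  exists2 L : R, (0 <= L)%R & {ae mu, forall x, E (Phi_of Psi u) x <= L%:E}.
Proof.
move=> DPhi /(bounded_modular yPhi)[M M0 TM].
have [c c0 cP] := DPhi.
have K0 : (0 < 2 * M * c)%R by rewrite !mulr_gt0.
have [l l0 lP] := Delta'_superlinear yPhi yPsi DPhi K0.
exists (2 * M / l)%R; first by rewrite divr_ge0 ?mulr_ge0 ?ltW.
set L := (2 * M / l)%R.
have L0 : (0 <= L)%R by rewrite divr_ge0 ?mulr_ge0 ?ltW.
have mP : measurable_fun [set: X] (Phi_of Psi u) by exact/measurable_EFinP.
have P0 x : 0 <= Phi_of Psi u x by rewrite lee_fin young_ge0.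
have [mE E0 intE] := condexpP subA sfA mP P0.
apply: (ae_le_of_integrals subA sfA) => // B AB Boo; rewrite -intE//.
have mB := sub_measurable subA AB.
have BD : B = \bigcup_n (B `&` D n).
  rewrite -setI_bigcupr (_ : \bigcup_n D n = setT) ?setIT//.
  apply/seteqP; split => // x _; exists (Num.bound (cmodulus (u x))) => //=.
  by apply/ltW/archi_boundP/cmodulus_ge0.
have cvgB : \int[mu]_(x in B `&` D n) Phi_of Psi u x @[n --> \oo] -->
    \int[mu]_(x in \bigcup_n (B `&` D n)) Phi_of Psi u x.
  apply: ge0_nondecreasing_set_cvg_integral.
  - move=> n m nm; apply/subsetPset => x [Bx Dx]; split => //.
    by rewrite /D/= (le_trans Dx)// ler_nat.
  - by move=> n; exact: measurableI.
  - by move=> n; exact: measurable_funTS.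
  - by move=> n x _; exact: P0.
rewrite [leLHS](_ : _ = \int[mu]_(x in \bigcup_n (B `&` D n)) Phi_of Psi u x); last by rewrite -BD.
rewrite -(cvg_lim _ cvgB)//; apply: lime_le; first by apply/cvg_ex; eexists; exact: cvgB.
apply: nearW => n.
have [mS S0 intS] := condexpP subA sfA (mhE n) (h0 n).
have -> : \int[mu]_(x in B `&` D n) Phi_of Psi u x = \int[mu]_(x in B) (EFin \o h n) x.
  rewrite integral_mkcondr epatch_indic; apply: eq_integral => x _ /=.
  by rewrite muleC.
rewrite intS//.
apply: ae_ge0_le_integral => //.
- exact: (sub_measurable_funS subA).
have H := condexp_truncated_le n c0 cP M0 TM l0 lP.
by apply: filterS H => x + _.
Qed.
End complementary_bound.

(** * Sufficiency of the conditional Hoelder inequality *)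

Section hoelder_sufficiency.
Context d (X : measurableType d) {R : realType}.
Variables (mu : {measure set X -> \bar R}) (A : set (set X)).
Hypothesis subA : sub_sigma_algebra A.
Local Notation XA := (g_sigma_algebraType A).
Hypothesis sfA : sigma_finite [set: XA] (mu : set XA -> \bar R).
Local Notation E := (condexp mu A).
Variable Phi : R -> R.
Hypothesis yPhi : young Phi.
Local Notation Psi := (complementary Phi).
Hypothesis yPsi : young Psi.
Variable u : X -> R[i].
Hypothesis mu_u : cmeasurable u.
Local Notation T := (condexp_mul mu A u).
Local Notation w := (fun x => young_inv Psi (E (Phi_of Psi u) x)).
Variables C W : R.
Hypotheses (C0 : (0 < C)%R) (W0 : (0 < W)%R).
Hypothesis hoelder : cond_hoelder mu A Phi C.
Hypothesis wW : {ae mu, forall x, w x <= W%:E}.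

Let mPsiu : measurable_fun [set: X] (Phi_of Psi u).
Proof.
apply/measurable_EFinP; apply: measurableT_comp; first exact: measurable_young.
exact: measurable_cmodulus.
Qed.

Let Psiu0 x : 0 <= Phi_of Psi u x.
Proof. by rewrite lee_fin young_ge0. Qed.

Let ind (B : set X) : X -> R := \1_B.

Let mind B : A B -> measurable_fun [set: XA] (ind B : XA -> R).
Proof. by move=> AB; apply: (@measurable_indic _ XA); rewrite (sub_measurableE subA). Qed.

Let ind0 B x : (0 <= ind B x)%R. Proof. by rewrite /ind. Qed.

(** The multiplier itself need not belong to L^Psi, so the Hoelder inequality can only
be applied to its restrictions. *)
Lemma local_orlicz B : A B -> mu B < +oo ->
  orlicz mu Psi (fun x => ((ind B x)%:C%C * u x)%R).
Proof.
move=> AB Boo; have mB := sub_measurable subA AB.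
apply: modular_orlicz.
  apply: cmeasurableM => //; apply: cmeasurable_real.
  exact: (sub_measurable_fun subA (mind AB)).
rewrite (@integral_support _ _ _ _ B); last first.
  by move=> x nBx; rewrite /ind indicE memNset// mul0r /cmodulus Normc.normc0 young0.
have -> : \int[mu]_(x in B) (Psi (cmodulus ((ind B x)%:C%C * u x)%R))%:E =
    \int[mu]_(x in B) Phi_of Psi u x.
  by apply: eq_integral => x xB; rewrite /ind indicE xB mul1r.
have [mE E0 intE] := condexpP subA sfA mPsiu Psiu0.
rewrite intE// (@le_lt_trans _ _ (\int[mu]_(x in B) (Psi W)%:E))//.
  apply: ae_ge0_le_integral => //.
  - exact: (sub_measurable_funS subA).
  - by move=> x _; rewrite lee_fin young_ge0.
  - by apply: filterS wW => x; rewrite (young_inv_le yPsi (E0 x) (ltW W0)).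
by rewrite integral_cst// lte_mul_pinfty// ?lee_fin ?(young_ge0 yPsi).
Qed.

Lemma orliczZ (k : R) f : (0 < k)%R -> orlicz mu Phi f ->
  orlicz mu Phi (fun x => (k%:C%C * f x)%R).
Proof.
move=> k0 [mf [l l0 fl]]; split.
  by apply: cmeasurableM => //; apply: cmeasurable_real.
exists (l / k)%R; first by rewrite divr_gt0.
under eq_integral => x _ do
  rewrite cmodulusM cmodulus_real gtr0_norm// mulrA divfK ?lt0r_neq0//.
exact: fl.
Qed.

(** On each set of a countable exhaustion, the Hoelder inequality for [f / k] and the
restriction of [u] reads E(|u f|) / k <= C Phi^-1(E(Phi(f / k))) w; it remains to
use |T f| <= E(|u f|), w <= W, and to apply Phi. *)
Lemma condexp_mul_modular_ae (k : R) f : (0 < k)%R -> orlicz mu Phi f ->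
  {ae mu, forall x, (Phi (cmodulus (T f x) / (k * (C * W))))%:E <=
    E (fun x => (Phi (cmodulus (f x) / k))%:E) x}.
Proof.
move=> k0 of_; have [mf _] := of_.
have [F [AF Foo FT]] := sub_exhaustion subA sfA.
pose fk x : R[i] := (k^-1%:C%C * f x)%R.
have ofk : orlicz mu Phi fk by apply: orliczZ => //; rewrite invr_gt0.
pose m x := (cmodulus (u x * f x)%R)%:E.
have muf : cmeasurable (fun x => u x * f x)%R by exact: cmeasurableM.
have mm : measurable_fun [set: X] m by exact: measurable_ecmodulus.
have m0 x : 0 <= m x by rewrite lee_fin cmodulus_ge0.
have fkE : Phi_of Phi fk = (fun x => (Phi (cmodulus (f x) / k))%:E).
  apply/funext => x; rewrite /Phi_of /fk cmodulusM cmodulus_real gtr0_norm ?invr_gt0//.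
  by rewrite mulrC.
set e := E (fun x => (Phi (cmodulus (f x) / k))%:E).
have local n : {ae mu, forall x, F n x ->
    (k^-1)%:E * E m x <= C%:E * young_inv Phi (e x) * w x}.
  have mp : measurable_fun [set: XA] (fun x => k^-1 * ind (F n) x : R)%R.
    by apply: (@measurable_funM _ XA) => //; exact: mind.
  have p0 x : (0 <= k^-1 * ind (F n) x)%R by rewrite mulr_ge0// invr_ge0 ltW.
  have H1 := condexpM subA sfA mp p0 mm m0.
  have H2 := condexpM subA sfA (mind (AF n)) (ind0 (F n)) mPsiu Psiu0.
  have H3 := hoelder ofk (local_orlicz (AF n) (Foo n)).
  apply: filterS3 H1 H2 H3 => x h1 h2 + Fx.
  have -> : (fun x => (cmodulus (fk x * ((ind (F n) x)%:C%C * u x))%R)%:E) =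
      (fun x => (k^-1 * ind (F n) x)%:E * m x).
    apply/funext => y; rewrite /m /fk -EFinM !cmodulusM !cmodulus_real.
    by rewrite gtr0_norm ?invr_gt0// ger0_norm//; congr (_%:E); ring.
  have -> : Phi_of Psi (fun x => ((ind (F n) x)%:C%C * u x)%R) =
      (fun x => (ind (F n) x)%:E * Phi_of Psi u x).
    apply/funext => y; rewrite /Phi_of -EFinM cmodulusM cmodulus_real ger0_norm//.
    by rewrite /ind indicE; case: (_ \in _); rewrite ?mul1r// !mul0r young0.
  by rewrite h1 h2 fkE /ind indicE mem_set// mulr1 mul1e.
have glob : {ae mu, forall x, (k^-1)%:E * E m x <= C%:E * young_inv Phi (e x) * w x}.
  have /ae_foralln := local; apply: filterS => x Hx.
  by have [n Fx] := FT x; exact: Hx Fx.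
have jensen := cmodulus_ccondexp_le subA sfA muf.
apply: filterS3 glob jensen wW => x h1 h2 h3.
have e0 : 0 <= e x by exact: condexp_ge0.
rewrite -(le_young_inv yPhi e0); last first.
  by rewrite divr_ge0 ?cmodulus_ge0// !mulr_ge0// ltW.
have i0 := young_inv_ge0 yPhi e0.
have h4 : (k^-1)%:E * (cmodulus (T f x))%:E <= C%:E * young_inv Phi (e x) * W%:E.
  have k'0 : 0 <= (k^-1)%:E by rewrite lee_fin invr_ge0 ltW.
  apply: le_trans (lee_wpmul2l k'0 h2) _; apply: le_trans h1 _.
  by apply: lee_wpmul2l => //; rewrite mule_ge0// lee_fin ltW.
case: (young_inv Phi (e x)) i0 h4 => [a| |]//; last by move=> _ _; rewrite leey.
rewrite -!EFinM !lee_fin => a0 h4.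
rewrite ler_pdivrMr ?mulr_gt0// [leRHS](_ : _ = k * (C * a * W))%R; last by ring.
by rewrite -ler_pdivrMl.
Qed.

Lemma condexp_mul_modular (k : R) f : (0 < k)%R -> orlicz mu Phi f ->
  \int[mu]_x (Phi (cmodulus (T f x) / (k * (C * W))))%:E <=
  \int[mu]_x (Phi (cmodulus (f x) / k))%:E.
Proof.
move=> k0 of_; have [mf _] := of_.
have mg := measurable_modular_div yPhi k mf.
have [mE E0 intE] := condexpP subA sfA mg (fun x => young_ge0 yPhi _).
have AT : A setT.
  by rewrite -(sub_measurableE subA).
rewrite intE//; apply: ae_ge0_le_integral => //.
- by move=> x _; rewrite lee_fin young_ge0.
- by apply: measurable_modular_div => //; exact: sub_cmeasurable_ccondexp.
- exact: (sub_measurable_fun subA).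
- by apply: filterS (condexp_mul_modular_ae k0 of_).
Qed.

Lemma condexp_mul_orlicz f : orlicz mu Phi f -> orlicz mu Phi (T f).
Proof.
move=> of_; have [mf [k k0 fk]] := of_; split.
  exact: sub_cmeasurable_ccondexp.
exists (k^-1 * (C * W))^-1%R; first by rewrite invr_gt0 !mulr_gt0 ?invr_gt0.
have k'0 : (0 < k^-1)%R by rewrite invr_gt0.
apply: le_lt_trans fk.
have := condexp_mul_modular k'0 of_.
under eq_integral do rewrite mulrC.
under [X in _ <= X -> _]eq_integral do rewrite invrK mulrC.
by [].
Qed.

Lemma condexp_mul_luxemburg f : orlicz mu Phi f ->
  luxemburg mu Phi (T f) <= (C * W)%:E * luxemburg mu Phi f.
Proof.
move=> of_; have CW0 : (0 < C * W)%R by rewrite mulr_gt0.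
rewrite -lee_pdivrMl//; apply: le_ereal_inf_tmp => _ [k [k0 fk] <-].
rewrite lee_pdivrMl// -EFinM mulrC; apply: luxemburg_le; first by rewrite mulr_gt0.
exact: le_trans (condexp_mul_modular k0 of_) fk.
Qed.

End hoelder_sufficiency.

Theorem theorem2p1 (R : realType) (d : measure_display) (X : measurableType d)
    (mu : {measure set X -> \bar R}) (A : set (set X))
    (subA : sub_sigma_algebra A)
    (sfA : sigma_finite [set: g_sigma_algebraType A]
             (mu : set (g_sigma_algebraType A) -> \bar R))
    (Phi Psi : R -> R) (youngPhi : young Phi)
    (defPsi : Psi = complementary Phi) (youngPsi : young Psi)
    (u : X -> R[i]) (mu_u : cmeasurable u)
    (wdT : forall f, orlicz mu Phi f ->
             conditionable mu A (fun x => u x * f x)%R) :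
  let T := condexp_mul mu A u in
  let w := fun x => young_inv Psi (condexp mu A (Phi_of Psi u) x) in
  [/\ orlicz_bounded mu Phi T ->
        conditionable mu A u /\ cLinfty mu A (ccondexp mu A u),
      Delta' Phi -> orlicz_bounded mu Phi T -> Linfty mu A w
    & forall C : R, (0 < C)%R -> cond_hoelder mu A Phi C -> Linfty mu A w ->
        orlicz_bounded mu Phi T /\
        orlicz_opnorm mu Phi T <= C%:E * 'N[mu]_+oo[w]].
Proof.
subst Psi => T w.
have w0 x : 0 <= w x by apply: young_inv_ge0 => //; exact: condexp_ge0.
have mw : measurable_fun [set: g_sigma_algebraType A] (w : g_sigma_algebraType A -> \bar R).
  apply: (@measurable_young_inv _ _ youngPsi _ (g_sigma_algebraType A)).
    exact: measurable_condexp.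
  by move=> x; exact: condexp_ge0.
split.
- move=> bT; split.
    apply: (conditionable_of_finite_sets subA sfA mu_u) => B AB Boo.
    have mB := sub_measurable subA AB.
    apply: wdT; apply: modular_orlicz.
      by apply: cmeasurable_real; exact: measurable_indic.
    have := @modular_indic _ X R mu Phi youngPhi B 1%R mB ler01.
    under eq_integral do rewrite mul1r.
    by move=> ->; rewrite lte_mul_pinfty// lee_fin young_ge0.
  split; first exact: cmeasurable_ccondexp.
  have [M M0 HM] := bounded_ccondexp subA sfA youngPhi mu_u bT.
  apply: le_lt_trans (Linfty_norm_le (ltW M0) _) (ltry M).
  by apply: filterS HM => x; rewrite /= lee_fin ger0_norm// cmodulus_ge0.
- move=> DPhi bT; split => //.
  have [L L0 HL] := bounded_condexp_complementary subA sfA youngPhi youngPsi mu_u DPhi bT.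
  have [l l0 lL] := young_surj youngPsi L0.
  apply: le_lt_trans (Linfty_norm_le l0 _) (ltry l).
  apply: filterS HL => x; rewrite gee0_abs// -lL.
  by rewrite -(young_inv_le youngPsi (condexp_ge0 _ _ _ _) l0).
move=> C C0 hC [_ wfin].
set N := 'N[mu]_+oo[w] in wfin *.
have N0 : 0 <= N by exact: Lnorm_ge0.
have Nfin : N \is a fin_num by rewrite ge0_fin_numE.
have n0 : (0 <= fine N)%R by exact: fine_ge0.
have wN (W : R) : (fine N <= W)%R -> {ae mu, forall x, w x <= W%:E}.
  move=> NW; apply: filterS (ae_le_Linfty_norm mu w) => x.
  rewrite gee0_abs// => /le_trans; apply.
  by rewrite -/N -(fineK Nfin) lee_fin.
have WP (e : R) : (0 < e)%R -> (0 < fine N + e)%R by move=> e0; rewrite ltr_wpDl.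
have wNe (e : R) : (0 < e)%R -> {ae mu, forall x, w x <= (fine N + e)%:E}.
  by move=> e0; apply: wN; rewrite lerDl ltW.
split.
  split.
    by move=> f; exact: (condexp_mul_orlicz subA sfA youngPhi youngPsi mu_u C0
      (WP _ ltr01) hC (wNe _ ltr01)).
  exists (C * (fine N + 1))%R; first by rewrite mulr_ge0 ?ltW// ltr_wpDl.
  by move=> f; exact: (condexp_mul_luxemburg subA sfA youngPhi youngPsi mu_u C0
      (WP _ ltr01) hC (wNe _ ltr01)).
apply: ge_ereal_sup => _ [f [of_ f1] <-].
(* The bound C W holds for every W > 0 above the norm of w, which may itself be 0;
   W is taken e / C above it. *)
apply/lee_addgt0Pr => e e0.
have e'0 : (0 < e / C)%R by rewrite divr_gt0.
apply: le_trans (condexp_mul_luxemburg subA sfA youngPhi youngPsi mu_u C0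
      (WP _ e'0) hC (wNe _ e'0) of_) _.
rewrite (@le_trans _ _ ((C * (fine N + e / C))%:E * 1))//.
  by rewrite lee_wpmul2l// lee_fin mulr_ge0// ltW// WP.
rewrite mule1 -{2}(fineK Nfin) -EFinM -EFinD lee_fin mulrDr lerD2l.
by rewrite mulrC divfK// lt0r_neq0.
Qed.
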